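(* For $g\in L^{1}(\mathbb{R})$ put $\mathcal{F}^{-1}(g)(x)=\frac{1}{(2\pi)^{1/2}}\int_{-\infty}^{\infty}g(k)e^{ikx}\,dk$. (1) Let $f:\mathbb{R}\to\mathbb{R}$ be of class $C^{3}$, with $f$ and $\frac{df}{dx}$ of very moderate decrease, $\frac{d^{2}f}{dx^{2}}$ of very moderate decrease, and $f,f',f'',f'''$ all bounded. Then $\mathcal{F}(f)\in L^{1}(\mathbb{R})$, and $f(x)=\mathcal{F}^{-1}(\mathcal{F}(f))(x)$ for every $x\in\mathbb{R}$. (2) Let $f:\mathbb{R}\to\mathbb{R}$ be of class $C^{3}$, with $f$ of very moderate decrease, $\frac{df}{dx}$ of very moderate decrease and oscillatory, and $f,f',f'',f'''$ all bounded. Then $\mathcal{F}(f)\in L^{1}(\mathbb{R})$, and $f(x)=\mathcal{F}^{-1}(\mathcal{F}(f))(x)$ for every $x\in\mathbb{R}$.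
   Context: A function $g\in C(\mathbb{R})$ is of very moderate decrease if there is a constant $C>0$ with $|g(x)|\le \frac{C}{|x|}$ for all $|x|>1$. A function $g\in C(\mathbb{R})$ is oscillatory if there exist an infinite sequence of points $\{y_i: i\in\mathbb{Z}\}$, with $y_i<y_{i+1}$, such that $g$ is (weakly) monotone on each $(y_i,y_{i+1})$, $i\in\mathbb{Z}$, and a $\delta>0$ with $|y_{i+1}-y_i|\ge\delta$ for all $i\in\mathbb{Z}$. For continuous $f$ of very moderate decrease (so $f\in L^{2}(\mathbb{R})$), $\mathcal{F}(f)\in L^{2}(\mathbb{R})$ denotes the Fourier transform $\mathcal{F}(f)(k)=\frac{1}{(2\pi)^{1/2}}\lim_{r\to\infty}\int_{-r}^{r}f(y)e^{-iky}\,dy$, the limit being taken in $L^{2}(\mathbb{R})$ (equivalently, almost everywhere in $k$ along a suitable sequence $r_n\to\infty$). *)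

(* Defs.v *)
From HB Require Import structures.
From mathcomp Require Import all_boot all_order all_algebra.
From mathcomp Require Import complex.
From mathcomp Require Import all_classical all_reals all_analysis.

Set Implicit Arguments.
Unset Strict Implicit.
Unset Printing Implicit Defensive.

Import Order.TTheory GRing.Theory Num.Theory.
Import numFieldNormedType.Exports.

Local Open Scope complex_scope.
Local Open Scope ring_scope.
Local Open Scope classical_set_scope.

Section RealFunctions.
Context {R : realType}.
Implicit Types g : R -> R.

Definition class_C (n : nat) g : Prop :=
  (forall i x, (i < n)%N -> derivable g^`(i) x 1) /\ continuous g^`(n).

Definition very_moderate_decrease g : Prop :=
  continuous g /\
  exists2 C : R, 0 < C & forall x, 1 < `|x| -> `|g x| <= C / `|x|.

Definition monotone_on (D : set R) g : Prop :=
  {in D &, nondecreasing_fun g} \/ {in D &, nonincreasing_fun g}.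

Definition oscillatory g : Prop :=
  continuous g /\
  exists y : int -> R,
    [/\ forall i, y i < y (i + 1),
        forall i, monotone_on `]y i, y (i + 1)[ g &
        exists2 delta : R, 0 < delta &
          forall i, delta <= `|y (i + 1) - y i|].

End RealFunctions.

Section Fourier.
Context {R : realType}.
Notation mu := (@lebesgue_measure R).
Implicit Types (f : R -> R) (F G : R -> R[i]).

Definition expi (t : R) : R[i] := cos t +i* sin t.

Definition Cintegral (D : set R) G : R[i] :=
  (\int[mu]_(x in D) complex.Re (G x)) +i* (\int[mu]_(x in D) complex.Im (G x)).

Definition CLfun (p : \bar R) G : Prop :=
  (fun k => complex.Re (G k)) \in Lfun mu p /\ 
  (fun k => complex.Im (G k)) \in Lfun mu p.

Definition L2dist F G : \bar R :=
  ('N[mu]_2%:E[(fun k => (ComplexField.Normc.normc (F k - G k)%R)%:E)])%E.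

Definition trunc_fourier f (r k : R) : R[i] :=
  (Num.sqrt (2 * pi))^-1%:C *
  Cintegral `[- r, r] (fun y => (f y)%:C * expi (- (k * y))).

Definition is_fourier f F : Prop :=
  CLfun 2%:E F /\ L2dist (trunc_fourier f r) F @[r --> +oo%R] --> 0%E.

(* An element of L^2 is determined only up to a null set: [fourier f] is an
   arbitrary representative of the L^2-limit, and the zero function when there
   is no such limit. *)
Definition fourier f : R -> R[i] := xget (fun=> 0) (is_fourier f).

Definition inverse_fourier G (x : R) : R[i] :=
  (Num.sqrt (2 * pi))^-1%:C * Cintegral setT (fun k => G k * expi (k * x)).

End Fourier.

(* Main.v *)
(* As f and f' are O(1/|x|), both are square integrable; since k F(f)(k) is
   -i F(f')(k), the function (1 + k^2) |F(f)(k)|^2 is integrable, hence so is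
   F(f), by AM-GM against 1/(1 + k^2).  The L^2 bounds come from the Abel weight
   w(k) = e^(-e|k|), whose transform is the Poisson kernel P_e: by Fubini,
     int w |h^|^2 = int int h(y) h(z) P_e(y - z) dy dz <= 2 pi int h^2,
   and e -> 0 gives Plancherel's inequality.  Applied to f restricted to
   r < |x| <= s it bounds the squared L^2 distance of the truncated transforms
   by O(1/r), so that they converge almost everywhere along r = 16^n, and then
   in L^2 by Fatou.  Inversion follows from the same kernel: the weighted inverse
   transform of F(f) is the Poisson integral of f, which tends to f(x). *)

Require Import Defs.
From HB Require Import structures.
From mathcomp Require Import all_boot all_order all_algebra.
From mathcomp Require Import complex.
From mathcomp Require Import all_classical all_reals all_analysis.
From mathcomp Require Import measurable_realfun.
From mathcomp Require Import ring lra.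
Import Order.TTheory GRing.Theory Num.Theory.
Import numFieldNormedType.Exports.

Local Open Scope complex_scope.
Local Open Scope ring_scope.
Local Open Scope classical_set_scope.

Set Implicit Arguments.
Unset Strict Implicit.
Unset Printing Implicit Defensive.

(** The weight makes Fubini legitimate: without it the integral of cos (k (y - z)) over k diverges,
    and the transform of a truncation is a priori only bounded. The inequality for the double
    integral is the Schur test: |h(y) h(z)| is at most (h(y)^2 + h(z)^2) / 2, and the kernel has
    mass 2 pi in each variable. The same mass replaces improper integrals in the tail estimates,
    since C^2 / x^2 is at most (C^2 / r) P_r(x) for |x| >= r. The relation between the transforms of
    f and f' is used on truncations, where it carries boundary terms of size O(1/r) that do not
    decay in k. Hence the frequency is cut at |k| <= n before r is chosen, and Fatou removes the
    cut. The ratio 16 leaves room for a factor 4^n in front of the squared increments, whose sum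
    stays integrable. As [fourier] picks some L^2 limit, the facts about it are derived from
    [transform_limit], which every representative satisfies. The analysis is done on real functions,
    through cosine and sine transforms. *)

Section FourierInversion.
Context {R : realType}.
Notation mu := (@lebesgue_measure R).
Implicit Types (f g F : R -> R) (e k x : R).

(** * Integrability on the line *)

Definition summable1 f := mu.-integrable setT (EFin \o f).

Lemma summable1_measurable f : summable1 f -> measurable_fun setT f.
Proof. by move=> /integrableP[/measurable_EFinP]. Qed.

Lemma summable1_le f g : measurable_fun setT f -> (forall x, `|f x| <= g x) ->
  summable1 g -> summable1 f.
Proof.
move=> mf fg; apply: le_integrable => //; first exact/measurable_EFinP.
by move=> x _; rewrite lee_fin (le_trans (fg x))// ler_norm.
Qed.

Lemma summable1Z c f : summable1 f -> summable1 (fun x => c * f x).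
Proof.
move=> iff; apply: eq_integrable (integrableZl measurableT c iff) => // x _.
Qed.

Lemma summable1M w f M : measurable_fun setT f -> (forall x, `|f x| <= M) ->
  summable1 w -> summable1 (fun x => w x * f x).
Proof.
move=> mf fM iw; apply: (@summable1_le _ (fun x => M * `|w x|)).
- by apply: measurable_funM => //; exact: summable1_measurable.
- by move=> x; rewrite normrM mulrC ler_wpM2r.
- exact: (summable1Z M (integrable_norm iw)).
Qed.

Lemma summable1D f g : summable1 f -> summable1 g ->
  summable1 (fun x => f x + g x).
Proof. exact: integrableD. Qed.

Lemma summable1B f g : summable1 f -> summable1 g ->
  summable1 (fun x => f x - g x).
Proof. exact: integrableB. Qed.

Lemma ler_norm_Rintegral f g : measurable_fun setT f -> (forall x, `|f x| <= g x) ->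
  summable1 g -> `|\int[mu]_x f x| <= \int[mu]_x g x.
Proof.
move=> mf fg ig; have iff := summable1_le mf fg ig.
apply: le_trans (le_normr_Rintegral measurableT iff) _.
by apply: le_Rintegral => //; exact: integrable_norm.
Qed.

Lemma EFin_Rintegral f : summable1 f -> (\int[mu]_x f x)%:E = (\int[mu]_x (f x)%:E)%E.
Proof. by move=> iff; rewrite /Rintegral fineK//; exact: integrable_fin_num. Qed.

Lemma ge0_summable1P f : measurable_fun setT f -> (forall x, 0 <= f x) ->
  summable1 f <-> (\int[mu]_x (f x)%:E < +oo)%E.
Proof.
move=> mf f0; split => [/integrableP[_]|fy].
  by under eq_integral do rewrite /= ger0_norm//.
apply/integrableP; split; first exact/measurable_EFinP.
by under eq_integral do rewrite /= ger0_norm//.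
Qed.

Lemma cvg_Rintegral (F : nat -> R -> R) f g :
  (forall n, measurable_fun setT (F n)) -> measurable_fun setT f -> summable1 g ->
  (forall n x, `|F n x| <= g x) -> (forall x, F n x @[n --> \oo] --> f x) ->
  \int[mu]_x F n x @[n --> \oo] --> \int[mu]_x f x.
Proof.
move=> mF mf ig Fg Ff.
have Ff' : {ae mu, forall x, setT x -> (F n x)%:E @[n --> \oo] --> (f x)%:E}.
  by apply: aeW => x _; apply: cvg_EFin; [exact: nearW|exact: Ff].
have Fg' : {ae mu, forall x n, setT x -> (`|(F n x)%:E| <= (g x)%:E)%E}.
  by apply: aeW => x n _; rewrite lee_fin.
have [iff _ cF] := @dominated_convergence _ _ _ mu setT measurableT
  (fun n => EFin \o F n) (EFin \o f) (EFin \o g)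
  (fun n => (measurable_EFinP _ _).2 (mF n)) ((measurable_EFinP _ _).2 mf)
  Ff' ig Fg'.
apply: fine_cvg; rewrite [X in _ --> X](_ : _ = \int[mu]_x (f x)%:E)%E; first exact: cF.
exact: EFin_Rintegral.
Qed.

Lemma is_derive_continuous f F : (forall x : R, is_derive x 1 F (f x)) -> continuous F.
Proof.
by move=> dF x; apply: differentiable_continuous; apply/derivable1_diffP; case: (dF x).
Qed.

(** Each half-line is handled by the one-sided theorem, the negative one after the reflection y ->
    -y, which turns the antiderivative into [- F (- y)] with limit [- m]. *)
Lemma ge0_continuous_FTC2T f F (l m : R) : (forall x, 0 <= f x) ->
  continuous f -> (forall x : R, is_derive x 1 F (f x)) ->
  F x @[x --> +oo] --> l -> F x @[x --> -oo] --> m ->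
  (\int[mu]_x (f x)%:E = (l - m)%:E)%E.
Proof.
move=> f0 cf dF Fl Fm.
have cF := is_derive_continuous dF.
have mf : measurable_fun setT f by exact: continuous_measurable_fun.
have dF1 x : F^`() x = f x by rewrite derive1E; have [_ ->] := dF x.
rewrite -(setUv [set x : R | 0 <= x]%R) -set_itvcy ge0_integral_setU//= ; last 4 first.
  exact: measurableC.
  by apply/measurable_EFinP; rewrite setUv.
  by move=> x _; rewrite lee_fin.
  exact/disj_setPCl.
rewrite (@ge0_continuous_FTC2y _ f F 0 l)//; last 2 first.
- exact: continuous_subspaceT.
- by apply: cvg_at_right_filter; exact: cF.
rewrite setCitvr.
rewrite integral_itv_bndo_bndc; last exact/measurable_EFinP/measurable_funTS.
have -> : (\int[mu]_(x in `]-oo, 0%R]) (f x)%:E)%E =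
    (\int[mu]_(x in `[0%R, +oo[) ((f \o -%R) x)%:E)%E.
  rewrite -ge0_integration_by_substitutionNy ?oppr0//.
  exact: continuous_subspaceT.
have dG (x : R) : is_derive x 1 (fun y => - F (- y)) (f (- x)).
  have -> : f (- x) = - (f (- x) * (- 1)) by ring.
  apply: is_deriveN.
rewrite (@ge0_continuous_FTC2y _ (f \o -%R) (fun y => - F (- y)) 0 (- m))//.
- by rewrite oppr0 -!EFinD; congr EFin; ring.
- by move=> x _ /=.
- apply: continuous_subspaceT => x; apply: continuous_comp; last exact: cf.
  exact: opp_continuous.
- by apply: cvgN; exact/cvgNy_compNP.
- apply: cvg_at_right_filter; apply: cvgN.
  by apply: (@continuous_comp _ _ _ -%R F); [exact: opp_continuous|exact: cF].
- by move=> x _ /=; rewrite derive1E; have [_ ->] := dG x.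
Qed.

(** * Poisson kernel and Abel weight *)

(** The Poisson kernel of the half-plane at height [e], multiplied by 2 pi: in this normalisation it
    is exactly the integral of [weight e k * cos (k * x)] over k, and its mass is 2 pi. *)
Definition poisson e x := 2 * e / (e ^+ 2 + x ^+ 2).

Lemma poisson_ge0 e x : 0 < e -> 0 <= poisson e x.
Proof.
by move=> e0; rewrite divr_ge0 ?mulr_ge0 ?addr_ge0 ?sqr_ge0 ?ltW.
Qed.

Lemma poissonN e x : poisson e (- x) = poisson e x.
Proof. by rewrite /poisson sqrrN. Qed.

Lemma continuous_poisson e : 0 < e -> continuous (poisson e).
Proof.
move=> e0 x; apply: cvgM; first exact: cvg_cst.
apply: cvgV; first by rewrite gt_eqF// ltr_pwDl ?exprn_gt0 ?sqr_ge0.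
by apply: cvgD; [exact: cvg_cst|exact: exprn_continuous].
Qed.


Lemma integral_poisson e x : 0 < e ->
  (\int[mu]_y (poisson e (y - x))%:E = (2 * pi)%:E)%E.
Proof.
move=> e0.
have -> : 2 * pi = (2 * (pi / 2)) - (2 * - (pi / 2)) :> R by field.
apply: (@ge0_continuous_FTC2T _ (fun y => 2 * atan (e^-1 * (y - x)))).
- by move=> y; exact: poisson_ge0.
- move=> y; apply: (@continuous_comp _ _ _ (fun y => y - x) (poisson e)).
    by apply: cvgB; [exact: cvg_id|exact: cvg_cst].
  exact: continuous_poisson.
- move=> y; apply: is_derive_eq.
  rewrite /poisson /GRing.scale/= subr0 mulr1.
  have E0 : e ^+ 2 + (y - x) ^+ 2 != 0.
    by rewrite gt_eqF// ltr_pwDl ?exprn_gt0 ?sqr_ge0.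
  have -> : 1 + (e^-1 * (y - x)) ^+ 2 = (e ^+ 2 + (y - x) ^+ 2) / e ^+ 2.
    by field; rewrite gt_eqF.
  by field; rewrite E0 gt_eqF.
- apply: cvgM; first exact: cvg_cst.
  apply: cvg_comp; last exact: cvgy_atan.
  apply: gt0_cvgMry; first by rewrite invr_gt0.
  exact: cvg_addrr.
- apply/cvgNy_compNP; rewrite mulrN.
  have -> : (fun y => 2 * atan (e^-1 * (y - x))) \o -%R =
            (fun y => - (2 * atan (e^-1 * (y + x)))).
    by apply/funext => y /=; rewrite -mulrN -atanN -mulrN; do 3 f_equal; ring.
  apply: cvgN; apply: cvgM; first exact: cvg_cst.
  apply: cvg_comp; last exact: cvgy_atan.
  apply: gt0_cvgMry; first by rewrite invr_gt0.
  exact: cvg_addrr.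
Qed.

Lemma measurable_poisson e : 0 < e -> measurable_fun setT (poisson e).
Proof. by move=> e0; apply: continuous_measurable_fun; exact: continuous_poisson. Qed.

Lemma summable1_poisson e x : 0 < e -> summable1 (fun y => poisson e (y - x)).
Proof.
move=> e0; apply/ge0_summable1P; last by rewrite integral_poisson// ltry.
- apply: measurableT_comp; first exact: measurable_poisson.
  exact: measurable_funB.
- by move=> y; exact: poisson_ge0.
Qed.

Lemma Rintegral_poisson e x : 0 < e -> \int[mu]_y poisson e (y - x) = 2 * pi.
Proof. by move=> e0; rewrite /Rintegral integral_poisson. Qed.

(** * Integrals over bounded and symmetric intervals *)

Lemma is_derive_LRcontinuous f F (a b : R) : (forall x : R, is_derive x 1 F (f x)) ->
  derivable_oo_LRcontinuous F a b.
Proof.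
move=> dF; split => [x _||]; first by case: (dF x).
- by apply: cvg_at_right_filter; exact: is_derive_continuous dF _.
- by apply: cvg_at_left_filter; exact: is_derive_continuous dF _.
Qed.

Lemma is_derive_derive1 f F (x : R) : is_derive x 1 F (f x) -> F^`() x = f x.
Proof. by rewrite derive1E => -[_ ->]. Qed.

Lemma Rintegral_FTC2 f F (a b : R) : a <= b -> continuous f ->
  (forall x : R, is_derive x 1 F (f x)) -> \int[mu]_(x in `[a, b]) f x = F b - F a.
Proof.
rewrite le_eqVlt => /predU1P[-> _ _|ab cf dF].
  by rewrite set_itv1 Rintegral_set1 subrr.
rewrite /Rintegral (@continuous_FTC2 _ f F)//.
- exact: continuous_subspaceT.
- exact: is_derive_LRcontinuous dF.
- by move=> x _; exact: is_derive_derive1.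
Qed.

Lemma continuous_integrable_itv f (a b : R) : continuous f ->
  mu.-integrable `[a, b] (EFin \o f).
Proof.
move=> cf; apply: continuous_compact_integrable; first exact: segment_compact.
exact: continuous_subspaceT.
Qed.

Lemma continuous_oppr_comp f : continuous f -> continuous (fun x => f (- x)).
Proof.
by move=> cf x; apply: (@continuous_comp _ _ _ -%R f); [exact: opp_continuous|exact: cf].
Qed.

Lemma Rintegral_symitv f (r : R) : 0 <= r -> continuous f ->
  \int[mu]_(x in `[- r, r]) f x = \int[mu]_(x in `[0, r]) (f x + f (- x)).
Proof.
move=> r0 cf; have := @Rintegral_itvB _ f (BLeft (- r)) (BRight r) 0.
rewrite Rintegral_itv_obnd_cbnd; last first.
  apply: integrableS (@continuous_integrable_itv f 0 r cf) => //.
  by apply: subset_itvr; rewrite bnd_simp.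
move=> /(_ (continuous_integrable_itv _ _ cf)) h.
have cN := continuous_oppr_comp cf.
rewrite RintegralD//; [|exact: continuous_integrable_itv|exact: continuous_integrable_itv].
rewrite -h ?bnd_simp ?oppr_le0//.
suff -> : \int[mu]_(x in `[0, r]) f (- x) = \int[mu]_(x in `[- r, 0]) f x by ring.
have := @integration_by_substitution_oppr R f 0 r r0 (continuous_subspaceT cf).
by rewrite oppr0 /Rintegral => ->.
Qed.

(** Lets an integral over the line be computed from an antiderivative on [-n, n]. *)
Lemma cvg_Rintegral_symitv f : summable1 f ->
  \int[mu]_(x in `[- n%:R, n%:R]) f x @[n --> \oo] --> \int[mu]_x f x.
Proof.
move=> sf; under eq_fun do rewrite Rintegral_mkcond.
apply: (@cvg_Rintegral _ _ (fun x => `|f x|)).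
- move=> n; apply/(measurable_restrictT _ _).1 => //.
  exact: measurable_funTS (summable1_measurable sf).
- exact: summable1_measurable.
- exact: integrable_norm.
- by move=> n x; rewrite patchE; case: ifP => // _; rewrite normr0.
- move=> x; apply: cvg_near_cst; exists (Num.bound `|x|) => // n /= xn.
  rewrite patchE mem_set//= in_itv/= -ler_norml.
  apply: le_trans (ltW (archi_boundP (normr_ge0 x))) _; by rewrite ler_nat.
Qed.

(** * The Abel weight and its transform *)

Definition weight e k := expR (- (e * `|k|)).

Lemma weight_ge0 e k : 0 <= weight e k. Proof. exact: expR_ge0. Qed.

Lemma weight_le1 e k : 0 <= e -> weight e k <= 1.
Proof. by move=> e0; rewrite -expR0 ler_expR oppr_le0 mulr_ge0. Qed.

Lemma weightN e k : weight e (- k) = weight e k.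
Proof. by rewrite /weight normrN. Qed.

Lemma continuous_weight e : continuous (weight e).
Proof.
move=> k; apply: continuous_comp; last exact: continuous_expR.
by apply: cvgN; apply: cvgM; [exact: cvg_cst|exact: norm_continuous].
Qed.

Lemma measurable_weight e : measurable_fun setT (weight e).
Proof. by apply: continuous_measurable_fun; exact: continuous_weight. Qed.

Lemma cvgy_expR_scale e : 0 < e -> expR (- (e * x)) @[x --> +oo] --> (0 : R).
Proof.
move=> e0; apply: (@cvg_comp _ _ _ (fun x : R => e * x) (fun x => expR (- x))
  +oo +oo); last exact: cvgr_expR.
  by apply: gt0_cvgMry => //; exact: cvg_id.
Qed.

Lemma summable1_weight e : 0 < e -> summable1 (weight e).
Proof.
move=> e0; apply/ge0_summable1P; [exact: measurable_weight|exact: weight_ge0|].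
rewrite ge0_symfun_integralT; [|exact: weight_ge0|exact: continuous_weight|].
  2: by move=> x /=; rewrite weightN.
rewrite -set_itvcy.
under eq_integral => x.
  rewrite inE/= in_itv/= andbT => x0; rewrite /weight ger0_norm//.
  over.
rewrite (@ge0_continuous_FTC2y _ _ (fun x => - (e^-1 * expR (- (e * x)))) 0 0).
- by rewrite -EFinB -EFinM ltry.
- by move=> x _; exact: expR_ge0.
- apply: continuous_subspaceT => x.
  by apply: continuous_comp; [apply: cvgN; exact: mulrl_continuous|exact: continuous_expR].
- rewrite -oppr0; apply: cvgN; rewrite -(mulr0 e^-1).
  by apply: cvgM; [exact: cvg_cst|exact: cvgy_expR_scale].
- by move=> x _; apply: ex_derive.
- apply: cvg_at_right_filter; apply: cvgN; apply: cvgM; first exact: cvg_cst.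
  by apply: continuous_comp; [apply: cvgN; exact: mulrl_continuous|exact: continuous_expR].
- move=> x _; rewrite derive1E; apply: derive_val.
  apply: is_derive_eq; rewrite /GRing.scale/=; field; exact: lt0r_neq0.
Qed.

Lemma summable1_weightM e f M : 0 < e -> measurable_fun setT f ->
  (forall x, `|f x| <= M) -> summable1 (fun k => weight e k * f k).
Proof. by move=> e0 mf fM; apply: summable1M mf fM (summable1_weight e0). Qed.

Lemma measurable_cosZ x : measurable_fun setT (fun k => cos (k * x)).
Proof.
apply: continuous_measurable_fun => k.
by apply: continuous_comp; [exact: mulrr_continuous|exact: continuous_cos].
Qed.

Lemma measurable_sinZ x : measurable_fun setT (fun k => sin (k * x)).
Proof.
apply: continuous_measurable_fun => k.
by apply: continuous_comp; [exact: mulrr_continuous|exact: continuous_sin].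
Qed.

Lemma Rintegral_weight_sin e x : 0 < e ->
  \int[mu]_k (weight e k * sin (k * x)) = 0.
Proof.
move=> e0; have /cvg_Rintegral_symitv h : summable1 (fun k => weight e k * sin (k * x)).
  by apply: (@summable1_weightM _ _ 1) => //; [exact: measurable_sinZ|move=> k;
    exact: sin_max].
apply: (cvg_unique (@Rhausdorff R) h); apply: cvg_near_cst; apply: nearW => n.
rewrite Rintegral_symitv//; last first.
  move=> k; apply: cvgM; first exact: continuous_weight.
  by apply: continuous_comp; [exact: mulrr_continuous|exact: continuous_sin].
under eq_Rintegral do rewrite weightN mulNr sinN mulrN subrr.
by rewrite Rintegral_cst// mul0r.
Qed.

Lemma Rintegral_weight_cos e x : 0 < e ->
  \int[mu]_k (weight e k * cos (k * x)) = poisson e x.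
Proof.
move=> e0.
have E0 : e ^+ 2 + x ^+ 2 != 0.
  by rewrite gt_eqF// ltr_pwDl ?exprn_gt0 ?sqr_ge0.
(* An antiderivative of 2 e^(-e k) cos (k x), as two integrations by parts give it; the 2 comes from
   folding [-n, n] onto [0, n]. Its value at 0 is [- poisson e x]. *)
pose V (k : R) := 2 * expR (- (e * k)) * (x * sin (k * x) - e * cos (k * x)) / (e ^+ 2 +
  x ^+ 2).
have /cvg_Rintegral_symitv h : summable1 (fun k => weight e k * cos (k * x)).
  by apply: (@summable1_weightM _ _ 1) => //; [exact: measurable_cosZ|move=> k;
    exact: cos_max].
apply: (cvg_unique (@Rhausdorff R) h).
have -> : (fun n : nat => \int[mu]_(k in `[- n%:R, n%:R]) (weight e k * cos (k * x))) =
    (fun n => V n%:R - V 0).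
  apply/funext => n; rewrite Rintegral_symitv//; last first.
    move=> k; apply: cvgM; first exact: continuous_weight.
    by apply: continuous_comp; [exact: mulrr_continuous|exact: continuous_cos].
  have <- : \int[mu]_(k in `[0, n%:R]) (2 * expR (- (e * k)) * cos (k * x)) =
      V n%:R - V 0.
    apply: Rintegral_FTC2 => //.
    - move=> k; apply: cvgM.
        apply: cvgM; first exact: cvg_cst.
        by apply: continuous_comp; [apply: cvgN;
          exact: mulrl_continuous|exact: continuous_expR].
      by apply: continuous_comp; [exact: mulrr_continuous|exact: continuous_cos].
    - move=> k; rewrite /V; apply: is_derive_eq; rewrite /GRing.scale/=.
      by field.
  apply: eq_Rintegral => k; rewrite inE/= in_itv/= => /andP[k0 _].
  by rewrite weightN mulNr cosN /weight ger0_norm//; ring.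
rewrite -[poisson e x]add0r; apply: cvgD; last first.
  rewrite (_ : - V 0 = poisson e x); first exact: cvg_cst.
  by rewrite /V /poisson mulr0 oppr0 expR0 !mul0r sin0 cos0; field.
(* A bound for |V n|, as sine and cosine are at most 1 in absolute value. *)
pose B (n : nat) := 2 * (`|x| + e) / (e ^+ 2 + x ^+ 2) * expR (- (e * n%:R)).
have cB : B n @[n --> \oo] --> (0 : R).
  rewrite -(mulr0 (2 * (`|x| + e) / (e ^+ 2 + x ^+ 2))); apply: cvgM; first exact: cvg_cst.
  exact: (@cvg_comp _ _ _ (fun n => n%:R) (fun x : R => expR (- (e * x))) _ _ _
    (@cvgr_idn R) (cvgy_expR_scale e0)).
apply: (@squeeze_cvgr _ _ _ _ (fun n => - B n) B) => //; last by rewrite -oppr0;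
  exact: cvgN.
apply: nearW => n; rewrite -ler_norml /V /B !normrM normfV.
rewrite (ger0_norm (expR_ge0 _)) (gtr0_norm (_ : 0 < 2))//
  (gtr0_norm (_ : 0 < e ^+ 2 + x ^+ 2)); last first.
  by rewrite ltr_pwDl ?exprn_gt0 ?sqr_ge0.
rewrite [leRHS](_ : _ =
  2 * expR (- (e * n%:R)) * (`|x| + e) / (e ^+ 2 + x ^+ 2)); last by field.
rewrite ler_wpM2r ?invr_ge0 ?addr_ge0 ?sqr_ge0// ler_wpM2l ?mulr_ge0 ?expR_ge0//.
apply: le_trans (ler_normB _ _) _; rewrite !normrM (gtr0_norm e0) lerD//.
  by rewrite ler_piMr// sin_max.
by rewrite ler_piMr ?cos_max// ltW.
Qed.

(** * Fubini *)

Definition swap_integrand (u w : R -> R) (phi : R * R -> R) (z : R * R) : R :=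
  w z.1 * (u z.2 * phi z).

(** As |phi| <= 1, the double integral of the absolute value is at most the product of the L^1 norms
    of [w] and [u]. *)
Lemma integrable_swap (u w : R -> R) (phi : R * R -> R) : summable1 u -> summable1 w ->
  measurable_fun setT phi -> (forall z, `|phi z| <= 1) ->
  (mu \x mu)%E.-integrable setT (EFin \o swap_integrand u w phi).
Proof.
move=> iu iw mphi phi1.
have mf : measurable_fun setT (swap_integrand u w phi).
  apply: measurable_funM.
    by apply: measurableT_comp; [exact: summable1_measurable iw|exact: measurable_fst].
  apply: measurable_funM => //.
  by apply: measurableT_comp; [exact: summable1_measurable iu|exact: measurable_snd].
apply/integrable12ltyP; first exact/measurable_EFinP.
have mnu : measurable_fun setT (EFin \o (Num.norm \o u)).
  by apply/measurable_EFinP; apply: measurableT_comp => //; exact: summable1_measurable iu.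
apply: (@le_lt_trans _ _ (\int[mu]_x ((`|w x| * \int[mu]_y `|u y|)%:E)))%E.
  apply: ge0_le_integral => //.
  - by move=> x _; apply: integral_ge0 => y _; rewrite lee_fin.
  - apply: (@measurable_fun_fubini_tonelli_F _ _ _ _ _ mu
      (abse \o (EFin \o swap_integrand u w phi))).
      by apply: measurableT_comp => //; exact/measurable_EFinP.
    by move=> z; exact: abse_ge0.
  - apply/measurable_EFinP; apply: measurable_funM => //.
    by apply: measurableT_comp => //; exact: summable1_measurable iw.
  - move=> x _; rewrite -RintegralZl//; last exact: integrable_norm.
    rewrite EFin_Rintegral; last by apply: summable1Z; exact: integrable_norm.
    apply: ge0_le_integral => //.
    + apply/measurable_EFinP; apply: measurableT_comp => //.
      exact: (@measurableT_comp _ _ _ _ _ _ (swap_integrand u w phi) _ (pair x)).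
    + apply/measurable_EFinP; apply: measurable_funM => //.
      exact/measurable_EFinP.
    + move=> y _; rewrite lee_fin /swap_integrand !normrM ler_wpM2l//.
      by rewrite ler_piMr.
rewrite -EFin_Rintegral ?ltry//.
have -> : (fun x => `|w x| * \int[mu]_y `|u y|) = (fun x => (\int[mu]_y `|u y|) * `|w x|).
  by apply/funext => x; rewrite mulrC.
by apply: summable1Z; exact: integrable_norm.
Qed.

(** Measurability of the partial integral is read off from Fubini, which asks for integrability in
    both variables. So an auxiliary factor [weight 1 k] is inserted and then cancelled by
    [expR |k|]. *)
Lemma measurable_Rintegral_kernel (u : R -> R) (phi : R * R -> R) : summable1 u ->
  measurable_fun setT phi -> (forall z, `|phi z| <= 1) ->
  measurable_fun setT (fun k => \int[mu]_y (u y * phi (k, y))).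
Proof.
move=> iu mphi phi1.
have h := measurable_fubini_F (integrable_swap iu (summable1_weight ltr01) mphi phi1).
have -> : (fun k => \int[mu]_y (u y * phi (k, y))) =
  (fun k => expR `|k| * fine (fubini_F mu (EFin \o swap_integrand u (weight 1) phi) k)).
  apply/funext => k.
  have ->: fine (fubini_F mu (EFin \o swap_integrand u (weight 1) phi) k) =
    \int[mu]_y (weight 1 k * (u y * phi (k, y))) by [].
  rewrite RintegralZl//.
    by rewrite mulrA /weight mul1r -expRD subrr expR0 mul1r.
  apply: (@summable1M _ _ 1) => //.
  exact: (@measurableT_comp _ _ _ _ _ _ phi _ (pair k)).
apply: measurable_funM.
  by apply: measurableT_comp => //; exact: measurableT_comp.
by apply: measurableT_comp => //.
Qed.

Lemma Rintegral_swap (u w : R -> R) (phi : R * R -> R) : summable1 u -> summable1 w ->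
  measurable_fun setT phi -> (forall z, `|phi z| <= 1) ->
  \int[mu]_k (w k * \int[mu]_y (u y * phi (k, y))) =
  \int[mu]_y (u y * \int[mu]_k (w k * phi (k, y))).
Proof.
move=> iu iw mphi phi1.
have mphi1 k : measurable_fun setT (fun y => phi (k, y)).
  exact: (@measurableT_comp _ _ _ _ _ _ phi _ (pair k)).
have mphi2 y : measurable_fun setT (fun k => phi (k, y)).
  exact: (@measurableT_comp _ _ _ _ _ _ phi _ (pair^~ y)).
have i1 k : summable1 (fun y => u y * phi (k, y)) by exact: summable1M (mphi1 k) _ iu.
have i2 y : summable1 (fun k => w k * phi (k, y)) by exact: summable1M (mphi2 y) _ iw.
transitivity (fine (\int[mu]_k \int[mu]_y (swap_integrand u w phi (k, y))%:E)).
  congr fine; apply: eq_integral => k _; rewrite -RintegralZl; [|by []|exact: i1].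
  by rewrite EFin_Rintegral//; exact: summable1Z.
rewrite (Fubini (integrable_swap iu iw mphi phi1)); congr fine.
apply: eq_integral => y _; rewrite -RintegralZl; [|by []|exact: i2].
rewrite EFin_Rintegral; last exact: summable1Z.
by apply: eq_integral => k _; rewrite /swap_integrand/= mulrCA.
Qed.

Lemma poisson_le e x : 0 < e -> poisson e x <= 2 / e.
Proof.
move=> e0; rewrite /poisson ler_pdivrMr; last by rewrite ltr_pwDl ?exprn_gt0 ?sqr_ge0.
rewrite mulrDr [leLHS](_ : _ = 2 / e * e ^+ 2); last by field; exact: lt0r_neq0.
by rewrite lerDl mulr_ge0 ?sqr_ge0// divr_ge0// ltW.
Qed.

Lemma summable1M_poisson e f y : 0 < e -> summable1 f ->
  summable1 (fun z => f z * poisson e (z - y)).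
Proof.
move=> e0 iff; apply: (@summable1M _ _ (2 / e)) => //.
  exact: summable1_measurable (summable1_poisson y e0).
by move=> z; rewrite ger0_norm ?poisson_ge0 ?poisson_le.
Qed.

(** By Tonelli, each mass [v z] is spread by a kernel of total mass 2 pi. With v = h^2 this gives
    one half of the Schur test. *)
Lemma Rintegral_convolution_poisson e (v : R -> R) : 0 < e -> summable1 v -> (forall x,
  0 <= v x) ->
  let T y := \int[mu]_z (v z * poisson e (z - y)) in
  summable1 T /\ \int[mu]_y T y = 2 * pi * \int[mu]_z v z.
Proof.
move=> e0 iv v0 T.
pose F (z : R * R) := v z.2 * poisson e (z.2 - z.1).
have mF : measurable_fun setT F.
  apply: measurable_funM.
    by apply: measurableT_comp; [exact: summable1_measurable iv|exact: measurable_snd].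
  apply: measurableT_comp; first exact: measurable_poisson.
  by apply: measurable_funB; [exact: measurable_snd|exact: measurable_fst].
have F0 z : (0 <= (EFin \o F) z)%E by rewrite lee_fin mulr_ge0// poisson_ge0.
have mEF : measurable_fun setT (EFin \o F) by exact/measurable_EFinP.
have ET y : (\int[mu]_z ((EFin \o F) (y, z)))%E = (T y)%:E.
  by rewrite EFin_Rintegral//; exact: summable1M_poisson.
have mT : measurable_fun setT T.
  apply/measurable_EFinP; rewrite (_ : EFin \o T = fubini_F mu (EFin \o F)).
    exact: measurable_fun_fubini_tonelli_F.
  by apply/funext => y; rewrite /fubini_F ET.
have T0 y : 0 <= T y by apply: Rintegral_ge0 => z _; rewrite mulr_ge0// poisson_ge0.
have IT : (\int[mu]_y (T y)%:E = (2 * pi * \int[mu]_z v z)%:E)%E.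
  under eq_integral do rewrite -ET.
  transitivity (\int[mu]_z \int[mu]_y ((EFin \o F) (y, z)))%E.
    exact: (@fubini_tonelli _ _ _ _ _ mu mu (EFin \o F) mEF F0).
  rewrite -RintegralZl// EFin_Rintegral; last exact: summable1Z.
  apply: eq_integral => z _; rewrite /F/=.
  rewrite -EFin_Rintegral; last first.
    apply: summable1Z.
    have := summable1_poisson z e0.
    rewrite (_ : (fun y => poisson e (y - z)) = (fun y => poisson e (z - y)))//.
    by apply/funext => y; rewrite -poissonN opprB.
  rewrite RintegralZl//; last first.
    have := summable1_poisson z e0.
    rewrite (_ : (fun y => poisson e (y - z)) = (fun y => poisson e (z - y)))//.
    by apply/funext => y; rewrite -poissonN opprB.
  rewrite mulrC; congr (_ * _)%:E; rewrite -(Rintegral_poisson z e0).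
  by apply: eq_Rintegral => y _; rewrite -poissonN opprB.
split; last by rewrite /Rintegral IT.
by apply/ge0_summable1P => //; rewrite IT ltry.
Qed.

(** * Plancherel's inequality *)

(* For real h, the transform of h is, up to the factor 1 / sqrt (2 pi),
   cos_transform h - i sin_transform h. *)
Definition cos_transform (h : R -> R) k := \int[mu]_y (h y * cos (k * y)).
Definition sin_transform (h : R -> R) k := \int[mu]_y (h y * sin (k * y)).

Lemma measurable_mul_pair : measurable_fun setT (fun z : R * R => z.1 * z.2).
Proof. exact: measurable_funM. Qed.

Lemma measurable_cos_pair : measurable_fun setT (fun z : R * R => cos (z.1 * z.2)).
Proof.
apply: measurableT_comp; last exact: measurable_mul_pair.
by apply: continuous_measurable_fun; exact: continuous_cos.
Qed.

Lemma measurable_sin_pair : measurable_fun setT (fun z : R * R => sin (z.1 * z.2)).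
Proof.
apply: measurableT_comp; last exact: measurable_mul_pair.
by apply: continuous_measurable_fun; exact: continuous_sin.
Qed.

Lemma measurable_cos_transform (h : R -> R) : summable1 h ->
  measurable_fun setT (cos_transform h).
Proof.
move=> ih; apply: (measurable_Rintegral_kernel ih measurable_cos_pair) => z.
exact: cos_max.
Qed.

Lemma measurable_sin_transform (h : R -> R) : summable1 h ->
  measurable_fun setT (sin_transform h).
Proof.
move=> ih; apply: (measurable_Rintegral_kernel ih measurable_sin_pair) => z.
exact: sin_max.
Qed.

Lemma measurable_cosM x : measurable_fun setT (fun k => cos (x * k)).
Proof. by have := measurable_cosZ x; under eq_fun do rewrite mulrC. Qed.

Lemma measurable_sinM x : measurable_fun setT (fun k => sin (x * k)).
Proof. by have := measurable_sinZ x; under eq_fun do rewrite mulrC. Qed.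

Lemma summable1_cos (h : R -> R) k : summable1 h -> summable1 (fun y => h y * cos (k * y)).
Proof.
by move=> ih; apply: summable1M ih; [exact: measurable_cosM|move=> y; exact: cos_max].
Qed.

Lemma summable1_sin (h : R -> R) k : summable1 h -> summable1 (fun y => h y * sin (k * y)).
Proof.
by move=> ih; apply: summable1M ih; [exact: measurable_sinM|move=> y; exact: sin_max].
Qed.

Lemma cos_transform_le (h : R -> R) k : summable1 h ->
  `|cos_transform h k| <= \int[mu]_y `|h y|.
Proof.
move=> ih; apply: ler_norm_Rintegral; last exact: integrable_norm.
  by apply: summable1_measurable; exact: summable1_cos.
by move=> y; rewrite normrM ler_piMr// cos_max.
Qed.

Lemma sin_transform_le (h : R -> R) k : summable1 h ->
  `|sin_transform h k| <= \int[mu]_y `|h y|.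
Proof.
move=> ih; apply: ler_norm_Rintegral; last exact: integrable_norm.
  by apply: summable1_measurable; exact: summable1_sin.
by move=> y; rewrite normrM ler_piMr// sin_max.
Qed.

(** [Rintegral_swap] leaves the frequency as integration variable; the product k y being symmetric,
    the inner integral is again a transform, now of the weighted function. *)
Lemma cos_transformC (u : R -> R) y : \int[mu]_k (u k * cos (k * y)) = cos_transform u y.
Proof. by apply: eq_Rintegral => k _; rewrite [y * k]mulrC. Qed.

Lemma sin_transformC (u : R -> R) y : \int[mu]_k (u k * sin (k * y)) = sin_transform u y.
Proof. by apply: eq_Rintegral => k _; rewrite [y * k]mulrC. Qed.

(** The addition formula merges both products into cos (k (z - x)); after the interchange the
    integral over k is the transform of the weight. This is the real part of the weighted inverse
    transform, and serves Plancherel's inequality as well as inversion. *)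
Lemma weighted_cos_inversion e (h : R -> R) x : 0 < e -> summable1 h ->
  \int[mu]_k (weight e k * (cos_transform h k * cos (k * x) + sin_transform h k * sin (k
    * x))) =
  \int[mu]_z (h z * poisson e (z - x)).
Proof.
move=> e0 ih.
transitivity (\int[mu]_k (weight e k * \int[mu]_z (h z * cos (k * (z - x))))).
  apply: eq_Rintegral => k _; congr (_ * _).
  rewrite ![_ * cos (k * x)]mulrC ![_ * sin (k * x)]mulrC /cos_transform /sin_transform.
  rewrite -!RintegralZl//; [|exact: summable1_sin|exact: summable1_cos].
  rewrite -RintegralD//; [|by apply: summable1Z; exact: summable1_cos
                         |by apply: summable1Z; exact: summable1_sin].
  by apply: eq_Rintegral => z _; rewrite mulrBr cosB; ring.
have mphi : measurable_fun setT (fun z : R * R => cos (z.1 * (z.2 - x))).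
  apply: (measurableT_comp (f := cos)); first by apply: continuous_measurable_fun;
    exact: continuous_cos.
  apply: measurable_funM; first exact: measurable_fst.
  by apply: measurable_funB => //; exact: measurable_snd.
rewrite (Rintegral_swap ih (summable1_weight e0) mphi); last by move=> z; exact: cos_max.
by apply: eq_Rintegral => z _ /=; rewrite Rintegral_weight_cos.
Qed.

(** The imaginary counterpart: the interchange now leaves the sine transform of the weight, which
    vanishes because the weight is even. *)
Lemma weighted_sin_inversion e (h : R -> R) x : 0 < e -> summable1 h ->
  \int[mu]_k (weight e k * (sin_transform h k * cos (k * x) - cos_transform h k * sin (k
    * x))) = 0.
Proof.
move=> e0 ih.
transitivity (\int[mu]_k (weight e k * \int[mu]_z (h z * sin (k * (z - x))))).
  apply: eq_Rintegral => k _; congr (_ * _).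
  rewrite ![_ * cos (k * x)]mulrC ![_ * sin (k * x)]mulrC /cos_transform /sin_transform.
  rewrite -!RintegralZl//; [|exact: summable1_cos|exact: summable1_sin].
  rewrite -RintegralB//; [|by apply: summable1Z; exact: summable1_sin
                         |by apply: summable1Z; exact: summable1_cos].
  by apply: eq_Rintegral => z _; rewrite mulrBr sinB; ring.
have mphi : measurable_fun setT (fun z : R * R => sin (z.1 * (z.2 - x))).
  apply: (measurableT_comp (f := sin)); first by apply: continuous_measurable_fun;
    exact: continuous_sin.
  apply: measurable_funM; first exact: measurable_fst.
  by apply: measurable_funB => //; exact: measurable_snd.
rewrite (Rintegral_swap ih (summable1_weight e0) mphi); last by move=> z; exact: sin_max.
under eq_Rintegral => z _ /= do rewrite Rintegral_weight_sin// mulr0.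
by rewrite Rintegral_cst// mul0r.
Qed.

(** The left side is the pairing of [h] with its convolution by the kernel, to which the Schur test
    applies. The bound does not depend on [e]. *)
Lemma weighted_plancherel_le e (h : R -> R) : 0 < e -> summable1 h ->
  summable1 (fun x => h x ^+ 2) ->
  summable1 (fun k => weight e k * (cos_transform h k ^+ 2 + sin_transform h k ^+ 2)) /\
  \int[mu]_k (weight e k * (cos_transform h k ^+ 2 + sin_transform h k ^+ 2)) <=
  2 * pi * \int[mu]_x (h x ^+ 2).
Proof.
move=> e0 ih ih2; set M := \int[mu]_y `|h y|.
have mC := measurable_cos_transform ih; have mS := measurable_sin_transform ih.
have iC : summable1 (fun k => weight e k * cos_transform h k).
  by apply: (@summable1_weightM _ _ M) => // k; exact: cos_transform_le.
have iS : summable1 (fun k => weight e k * sin_transform h k).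
  by apply: (@summable1_weightM _ _ M) => // k; exact: sin_transform_le.
have iCC : summable1 (fun k => weight e k * cos_transform h k * cos_transform h k).
  by apply: summable1M iC => // k; exact: cos_transform_le.
have iSS : summable1 (fun k => weight e k * sin_transform h k * sin_transform h k).
  by apply: summable1M iS => // k; exact: sin_transform_le.
pose Q y := \int[mu]_z (h z * poisson e (z - y)).
have QE y : \int[mu]_k (weight e k * cos_transform h k * cos (k * y)) +
            \int[mu]_k (weight e k * sin_transform h k * sin (k * y)) = Q y.
  have iCc : summable1 (fun k => weight e k * cos_transform h k * cos (k * y)).
    by apply: summable1M iC; [exact: measurable_cosZ|move=> k; exact: cos_max].
  have iSs : summable1 (fun k => weight e k * sin_transform h k * sin (k * y)).
    by apply: summable1M iS; [exact: measurable_sinZ|move=> k; exact: sin_max].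
  rewrite -RintegralD//.
  rewrite -[RHS](weighted_cos_inversion y e0 ih).
  by apply: eq_Rintegral => k _; rewrite mulrDr !mulrA.
(* Only one factor of each square is expanded as an integral; the other stays with the weight and is
   transformed back, and the two results add up to [Q]. *)
have EQ : \int[mu]_k (weight e k * (cos_transform h k ^+ 2 + sin_transform h k ^+ 2)) =
    \int[mu]_y (h y * Q y).
  transitivity (\int[mu]_k (weight e k * cos_transform h k * cos_transform h k) +
                \int[mu]_k (weight e k * sin_transform h k * sin_transform h k)).
    by rewrite -RintegralD//; apply: eq_Rintegral => k _; ring.
  rewrite (Rintegral_swap ih iC measurable_cos_pair); last by move=> z; exact: cos_max.
  rewrite (Rintegral_swap ih iS measurable_sin_pair); last by move=> z; exact: sin_max.
  rewrite -RintegralD//; first by apply: eq_Rintegral => y _; rewrite -mulrDr QE.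
  - under eq_fun do rewrite cos_transformC.
    apply: summable1M ih; first exact: measurable_cos_transform.
    by move=> y; exact: cos_transform_le.
  - under eq_fun do rewrite sin_transformC.
    apply: summable1M ih; first exact: measurable_sin_transform.
    by move=> y; exact: sin_transform_le.
split.
  by apply: eq_integrable (summable1D iCC iSS) => // k _ /=; congr EFin; ring.
have [iT ET] := Rintegral_convolution_poisson e0 ih2 (fun x => sqr_ge0 (h x)).
set T := (fun y => \int[mu]_z _) in iT ET.
rewrite EQ.
(* Schur test: |h(y) h(z)| <= (h(y)^2 + h(z)^2) / 2 under the kernel. The first half integrates in z
   to pi h(y)^2, the second to T(y) / 2, and each contributes pi times the integral of h^2. *)
apply: (@le_trans _ _ (\int[mu]_y (pi * h y ^+ 2 + 2^-1 * T y))); last first.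
  rewrite RintegralD//; [|exact: summable1Z|exact: summable1Z].
  by rewrite !RintegralZl// ET le_eqVlt; apply/orP; left; apply/eqP; field.
apply: le_trans (ler_norm _) _.
apply: ler_norm_Rintegral; last by apply: summable1D; exact: summable1Z.
  apply: measurable_funM; first exact: summable1_measurable.
  rewrite (_ : Q = (fun y => cos_transform (fun k => weight e k * cos_transform h k) y +
                    sin_transform (fun k => weight e k * sin_transform h k) y)).
    by apply: measurable_funD; [exact: measurable_cos_transform|exact:
      measurable_sin_transform].
  by apply/funext => y; rewrite -QE cos_transformC sin_transformC.
move=> y; rewrite normrM.
have ihP := summable1M_poisson y e0 (integrable_norm ih).
have iP := summable1_poisson y e0.
have ihP2 : summable1 (fun z => h z ^+ 2 * poisson e (z - y)) by exact:
  summable1M_poisson ih2.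
apply: (@le_trans _ _ (`|h y| * \int[mu]_z (`|h z| * poisson e (z - y)))).
  rewrite ler_wpM2l//; apply: ler_norm_Rintegral => //.
    by apply: summable1_measurable; exact: summable1M_poisson.
  by move=> z; rewrite normrM (ger0_norm (poisson_ge0 _ _)).
rewrite -RintegralZl//.
apply: (@le_trans _ _ (\int[mu]_z (2^-1 * h y ^+ 2 * poisson e (z - y) +
                                    2^-1 * (h z ^+ 2 * poisson e (z - y))))); last first.
  rewrite RintegralD//; [|exact: summable1Z|exact: summable1Z].
  rewrite (RintegralZl _ measurableT iP) (RintegralZl _ measurableT ihP2).
  by rewrite Rintegral_poisson// lerD2r le_eqVlt; apply/orP; left; apply/eqP; field.
apply: le_Rintegral => //; first exact: summable1Z.
  by apply: summable1D; exact: summable1Z.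
move=> z _; rewrite mulrA [2^-1 * (_ * poisson _ _)]mulrA -mulrDl ler_wpM2r ?poisson_ge0//.
rewrite -(real_normK (num_real (h y))) -(real_normK (num_real (h z))).
have := sqr_ge0 (`|h y| - `|h z|); lra.
Qed.

(** The uniform bound passes to the lower limit, so integrability of the limit is a conclusion and
    no majorant has to be known beforehand. *)
Lemma fatou_le (F : nat -> R -> R) f (B : R) :
  (forall n, measurable_fun setT (F n)) -> (forall n x, 0 <= F n x) ->
  measurable_fun setT f -> (forall x, 0 <= f x) ->
  {ae mu, forall x, F n x @[n --> \oo] --> f x} ->
  (forall n, (\int[mu]_x (F n x)%:E <= B%:E)%E) ->
  summable1 f /\ \int[mu]_x f x <= B.
Proof.
move=> mF F0 mf f0 Ff FB.
pose G n := EFin \o F n.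
have mG n : measurable_fun setT (G n) by exact/measurable_EFinP.
have le1 : (\int[mu]_x (f x)%:E <= \int[mu]_x limn_einf (G^~ x))%E.
  apply: ae_ge0_le_integral => //.
  - by move=> x _; rewrite lee_fin.
  - exact/measurable_EFinP.
  - move=> x _; rewrite limn_einf_lim; apply: lime_ge; first exact: is_cvg_einfs.
    by apply: nearW => n; apply: le_ereal_inf_tmp => _ [m /= _ <-]; rewrite lee_fin.
  (* Measurability of the lower limit, taken as minus the upper limit of the negatives. *)
  - have mL : measurable_fun setT (fun x => limn_esup ((fun n y => - G n y)%E ^~ x)).
      by apply: measurable_fun_limn_esup => n; exact: measurableT_comp.
    exact: (measurableT_comp (@oppe_measurable R setT) mL).
  - apply: (@filterS _ _ (ae_filter_ringOfSetsType mu) _ _ _ Ff) => x cx _.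
    have /cvg_limn_einf_sup[-> _] // : G n x @[n --> \oo] --> (f x)%:E.
    by apply: cvg_EFin; [exact: nearW|exact: cx].
have le2 : (\int[mu]_x (f x)%:E <= B%:E)%E.
  apply: (le_trans le1); apply: (@le_trans _ _ _ _ _ (@fatou _ _ _ mu setT measurableT G
    mG _)).
    by move=> n x _; rewrite lee_fin.
  rewrite limn_einf_lim; apply: lime_le; first exact: is_cvg_einfs.
  by apply: nearW => n; apply: le_trans (FB n); apply: ge_ereal_inf; eexists;
    [exists n => /=|].
have sf : summable1 f.
  by apply/ge0_summable1P => //; apply: le_lt_trans le2 _; exact: ltry.
by split => //; rewrite -lee_fin EFin_Rintegral.
Qed.

Lemma cvg_weight k : weight (n.+1%:R^-1) k @[n --> \oo] --> (1 : R).
Proof.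
rewrite [X in _ --> X](_ : _ = expR (- (0 * `|k|))); last by rewrite mul0r oppr0 expR0.
apply: continuous_cvg; first exact: continuous_expR.
by apply: cvgN; apply: cvgM; [exact: cvg_harmonic|exact: cvg_cst].
Qed.

Lemma plancherel_le (h : R -> R) : summable1 h -> summable1 (fun x => h x ^+ 2) ->
  summable1 (fun k => cos_transform h k ^+ 2 + sin_transform h k ^+ 2) /\
  \int[mu]_k (cos_transform h k ^+ 2 + sin_transform h k ^+ 2) <=
  2 * pi * \int[mu]_x (h x ^+ 2).
Proof.
move=> ih ih2.
have e0 n : (0 : R) < n.+1%:R^-1 by rewrite invr_gt0.
have H n := weighted_plancherel_le (e0 n) ih ih2.
have mT : measurable_fun setT (fun k => cos_transform h k ^+ 2 + sin_transform h k ^+ 2).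
  apply: measurable_funD; apply: measurable_funX.
    exact: measurable_cos_transform.
  exact: measurable_sin_transform.
apply: (@fatou_le (fun n k => weight n.+1%:R^-1 k *
  (cos_transform h k ^+ 2 + sin_transform h k ^+ 2))) => //.
- by move=> n; apply: measurable_funM => //; exact: measurable_weight.
- by move=> n x; rewrite mulr_ge0 ?weight_ge0// addr_ge0 ?sqr_ge0.
- by move=> x; rewrite addr_ge0 ?sqr_ge0.
- apply: aeW => x; rewrite -[X in _ --> X]mul1r; apply: cvgM; first exact: cvg_weight.
  exact: cvg_cst.
- move=> n; have [i1 i2] := H n; rewrite -EFin_Rintegral// lee_fin.
Qed.


(** * Truncations of a decaying function *)

Definition trunc f (r : R) : R -> R := f \_ `[- r, r].

Lemma summable1_trunc f r : continuous f -> summable1 (trunc f r).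
Proof.
move=> cf; have := continuous_integrable_itv (- r) r cf.
by move=> /(integrable_mkcond _ _).1; rewrite restrict_EFin; apply.
Qed.

Lemma truncE f r x : trunc f r x = if `|x| <= r then f x else 0.
Proof.
rewrite /trunc patchE; case: ifPn => [|]; rewrite ?inE ?notin_setE /= in_itv/= -ler_norml.
  by move=> ->.
by move/negP/negbTE ->.
Qed.

Lemma trunc_sqr f r : (fun x => trunc f r x ^+ 2) = trunc (fun x => f x ^+ 2) r.
Proof. by apply/funext => x; rewrite !truncE; case: ifP => // _; rewrite expr0n. Qed.

Lemma continuous_sqr f : continuous f -> continuous (fun x => f x ^+ 2).
Proof. by move=> cf x; apply: (@continuous_comp _ _ _ f (fun y => y ^+ 2));
  [exact: cf|exact: exprn_continuous]. Qed.

Lemma summable1_trunc_sqr f r : continuous f -> summable1 (fun x => trunc f r x ^+ 2).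
Proof. by move=> cf; rewrite trunc_sqr; apply: summable1_trunc; exact: continuous_sqr. Qed.

Lemma cos_transformB f g k : summable1 f -> summable1 g ->
  cos_transform (fun x => f x - g x) k = cos_transform f k - cos_transform g k.
Proof.
move=> iff ig; rewrite /cos_transform -RintegralB//;
  [|exact: summable1_cos|exact: summable1_cos].
by apply: eq_Rintegral => x _; rewrite mulrBl.
Qed.

Lemma sin_transformB f g k : summable1 f -> summable1 g ->
  sin_transform (fun x => f x - g x) k = sin_transform f k - sin_transform g k.
Proof.
move=> iff ig; rewrite /sin_transform -RintegralB//;
  [|exact: summable1_sin|exact: summable1_sin].
by apply: eq_Rintegral => x _; rewrite mulrBl.
Qed.

(** Decay and boundedness with explicit constants: [C] governs the tail and [M] the part near 0, so
    that all later L^2 bounds are explicit. *)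
Definition decays f (C M : R) := [/\ continuous f, 0 < C, forall x, `|f x| <= M &
  forall x, 1 < `|x| -> `|f x| <= C / `|x|].

Lemma decays_sqr_le f C M x : decays f C M -> 1 < `|x| -> f x ^+ 2 <= C ^+ 2 / x ^+ 2.
Proof.
move=> [_ C0 _ fC] x1; rewrite -(real_normK (num_real (f x))) -(real_normK (num_real x)).
rewrite -expr_div_n ler_sqr ?nnegrE//; first exact: fC.
by rewrite divr_ge0// ltW.
Qed.

(** P_1(x) = 2 / (1 + x^2) is at least 1 on [-1, 1] and at least 1 / x^2 outside, so it dominates
    both regimes and its known mass bounds the integral of f^2. *)
Lemma decays_le_poisson f C M x : decays f C M ->
  f x ^+ 2 <= (C ^+ 2 + M ^+ 2) * poisson 1 x.
Proof.
move=> df; have [_ C0 fM _] := df; rewrite /poisson expr1n mulr1.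
have M0 : 0 <= M by exact: le_trans (fM 0).
have D0 : 0 < 1 + x ^+ 2 by rewrite ltr_pwDl ?sqr_ge0.
have C2 := sqr_ge0 C; have M2 := sqr_ge0 M; have x2 := sqr_ge0 x.
have [x1|x1] := leP `|x| 1.
  have fM2 : f x ^+ 2 <= M ^+ 2.
    by rewrite -(real_normK (num_real (f x))) ler_sqr ?nnegrE.
  have x21 : x ^+ 2 <= 1 by rewrite -(real_normK (num_real x)) -[leRHS](expr1n _ 2)
    ler_sqr ?nnegrE.
  rewrite mulrA ler_pdivlMr//; nra.
apply: (le_trans (decays_sqr_le df x1)).
have x21 : 1 < x ^+ 2.
  by rewrite -(real_normK (num_real x)) -[ltLHS](expr1n _ 2) ltr_sqr ?nnegrE.
rewrite ler_pdivrMr ?(lt_trans ltr01)// mulrA mulrAC ler_pdivlMr//; nra.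
Qed.

Lemma trunc_sqr_integral_le f C M r : decays f C M ->
  \int[mu]_x trunc f r x ^+ 2 <= 2 * pi * (C ^+ 2 + M ^+ 2).
Proof.
move=> df; have [cf _ _ _] := df.
have iP := summable1_poisson 0 ltr01.
rewrite mulrC -(Rintegral_poisson 0 ltr01) -RintegralZl//.
apply: le_Rintegral => //; [exact: summable1_trunc_sqr|exact: summable1Z|].
move=> x _; rewrite subr0 truncE; case: ifP => _; first exact: decays_le_poisson df.
by rewrite expr0n mulr_ge0 ?addr_ge0 ?sqr_ge0 ?poisson_ge0.
Qed.

(** Since b + c <= 2 c. With b = r^2 and c = x^2 it turns the tail 1 / x^2 into a Poisson kernel of
    width r. *)
Lemma ler_div_double (a b c : R) : 0 <= a -> 0 < b -> b <= c -> a / c <= 2 * a / (b + c).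
Proof.
move=> a0 b0 bc; have c0 : 0 < c by exact: lt_le_trans bc.
by rewrite ler_pdivrMr// mulrAC ler_pdivlMr ?addr_gt0//; nra.
Qed.

(** The difference lives on r < |x| <= s, where its square is at most C^2 / x^2, hence at most (C^2
    / r) P_r(x); the kernel has mass 2 pi. *)
Lemma truncB_sqr_integral_le f C M r s : decays f C M -> 1 <= r -> r <= s ->
  summable1 (fun x => (trunc f s x - trunc f r x) ^+ 2) /\
  \int[mu]_x (trunc f s x - trunc f r x) ^+ 2 <= 2 * pi * (C ^+ 2 / r).
Proof.
move=> df r1 rs; have [cf C0 _ _] := df.
have r0 : 0 < r by exact: lt_le_trans r1.
have iP := summable1_poisson 0 r0.
have iD : summable1 (fun x => (trunc f s x - trunc f r x) ^+ 2).
  rewrite (_ : (fun x => _) = fun x => trunc f s x ^+ 2 - trunc f r x ^+ 2).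
    by apply: summable1B; exact: summable1_trunc_sqr.
  apply/funext => x; rewrite !truncE; case: ifP => xs; case: ifP => xr.
  - by rewrite !subrr expr0n.
  - by rewrite expr0n !subr0.
  - by move: xs; rewrite (le_trans xr).
  - by rewrite subrr expr0n subrr.
split => //.
rewrite mulrC -(Rintegral_poisson 0 r0) -RintegralZl//.
apply: le_Rintegral => //; first exact: summable1Z.
move=> x _; rewrite subr0 !truncE.
have P0 : 0 <= C ^+ 2 / r * poisson r x.
  by rewrite mulr_ge0 ?poisson_ge0// divr_ge0 ?sqr_ge0// ltW.
case: ifP => xs; case: ifP => xr; rewrite ?subrr ?expr0n//.
  rewrite subr0; move/negbT: xr; rewrite -ltNge => xr.
  apply: (le_trans (decays_sqr_le df (le_lt_trans r1 xr))).
  have x2 : r ^+ 2 < x ^+ 2.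
    by rewrite -(real_normK (num_real x)) ltr_sqr ?nnegrE// ltW.
  have r2 : 0 < r ^+ 2 by rewrite exprn_gt0.
  rewrite /poisson [leRHS](_ : _ = 2 * C ^+ 2 / (r ^+ 2 + x ^+ 2)); last first.
    by field; rewrite !gt_eqF// addr_gt0// (lt_trans r2).
  exact: ler_div_double (sqr_ge0 C) r2 (ltW x2).
by move: xs; rewrite (le_trans xr).
Qed.

Lemma transform_truncB_le f C M r s : decays f C M -> 1 <= r -> r <= s ->
  summable1 (fun k => (cos_transform (trunc f s) k - cos_transform (trunc f r) k) ^+ 2 +
                      (sin_transform (trunc f s) k - sin_transform (trunc f r) k) ^+ 2) /\
  \int[mu]_k ((cos_transform (trunc f s) k - cos_transform (trunc f r) k) ^+ 2 +
              (sin_transform (trunc f s) k - sin_transform (trunc f r) k) ^+ 2) <=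
  (2 * pi * C) ^+ 2 / r.
Proof.
move=> df r1 rs; have [cf _ _ _] := df.
have [i2 l2] := truncB_sqr_integral_le df r1 rs.
have is_ := summable1_trunc s cf; have ir := summable1_trunc r cf.
have [i3 l3] := plancherel_le (summable1B is_ ir) i2.
have E : (fun k => (cos_transform (trunc f s) k - cos_transform (trunc f r) k) ^+ 2 +
    (sin_transform (trunc f s) k - sin_transform (trunc f r) k) ^+ 2) =
  (fun k => cos_transform (fun x => trunc f s x - trunc f r x) k ^+ 2 +
    sin_transform (fun x => trunc f s x - trunc f r x) k ^+ 2).
  by apply/funext => k; rewrite cos_transformB// sin_transformB.
rewrite E; split => //.
apply: (le_trans l3).
rewrite [leRHS](_ : _ = 2 * pi * (2 * pi * (C ^+ 2 / r))); last first.
  by field; rewrite gt_eqF// (lt_le_trans _ r1).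
by rewrite ler_wpM2l// mulr_ge0// pi_ge0.
Qed.

Lemma transform_trunc_le f C M r : decays f C M ->
  summable1 (fun k => cos_transform (trunc f r) k ^+ 2 + sin_transform (trunc f r) k ^+
    2) /\
  \int[mu]_k (cos_transform (trunc f r) k ^+ 2 + sin_transform (trunc f r) k ^+ 2) <=
  (2 * pi) ^+ 2 * (C ^+ 2 + M ^+ 2).
Proof.
move=> df; have [cf _ _ _] := df.
have [i l] := plancherel_le (summable1_trunc r cf) (summable1_trunc_sqr r cf).
split => //; apply: (le_trans l);
  rewrite [leRHS](_ : _ = 2 * pi * (2 * pi * (C ^+ 2 + M ^+ 2))); last by ring.
rewrite ler_wpM2l//; first by rewrite mulr_ge0// pi_ge0.
exact: trunc_sqr_integral_le df.
Qed.

(** * Existence of the L^2 limit *)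

(** The increments are at most sqrt s / 2^n, so the telescoping series converges absolutely. *)
Lemma cvg_of_geometric_sqr (u : nat -> R) (s : R) :
  (forall n, 4 ^+ n * (u n.+1 - u n) ^+ 2 <= s) -> cvgn u.
Proof.
move=> us.
have s0 : 0 <= s by apply: le_trans (us 0%N); rewrite mulr_ge0 ?sqr_ge0.
have dn n : `|u n.+1 - u n| <= Num.sqrt s * 2^-1 ^+ n.
  rewrite -[leLHS](ger0_norm (normr_ge0 _)) -ler_sqr ?nnegrE ?mulr_ge0 ?sqrtr_ge0
    ?exprn_ge0 ?invr_ge0//.
  rewrite exprMn sqr_sqrtr// -exprM mulnC exprM normr_id real_normK ?num_real//.
  rewrite exprVn exprVn ler_pdivlMr ?exprn_gt0//.
  by rewrite mulrC -natrX.
have : cvgn (series (telescope u)).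
  apply: normed_cvg; apply: (@series_le_cvg _ _ (geometric (Num.sqrt s) 2^-1)) => //.
  - by move=> n /=; exact: normr_ge0.
  - by move=> n /=; rewrite mulr_ge0 ?sqrtr_ge0 ?exprn_ge0 ?invr_ge0.
  - by apply: is_cvg_geometric_series; rewrite ger0_norm ?invr_ge0// invf_lt1 ?ltr1n.
rewrite telescopeK => cu.
rewrite (_ : u = fun n => (u n - u 0%N) + u 0%N); last by apply/funext => n; rewrite subrK.
by apply: is_cvgD => //; exact: is_cvg_cst.
Qed.

(** The series of squared increments weighted by 4^n has an integral of at most the sum of K / 4^n;
    it is therefore finite almost everywhere, and its value serves as the bound [s] of
    [cvg_of_geometric_sqr]. *)
Lemma ae_cvg_of_geometric_sqr (t : nat -> R -> R) (K : R) :
  (forall n, measurable_fun setT (t n)) ->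
  (forall n, summable1 (fun x => (t n.+1 x - t n x) ^+ 2) /\
     \int[mu]_x (t n.+1 x - t n x) ^+ 2 <= K / 16 ^+ n) ->
  {ae mu, forall x, cvgn (t ^~ x)}.
Proof.
move=> mt Ht.
pose d n x := 4 ^+ n * (t n.+1 x - t n x) ^+ 2.
have d0 n x : 0 <= d n x by rewrite mulr_ge0 ?sqr_ge0.
have md n : measurable_fun setT (d n).
  by apply: measurable_funM => //; apply: measurable_funX; exact: measurable_funB.
have K0 : 0 <= K.
  have [_] := Ht 0%N; rewrite divr1; apply: le_trans.
  by apply: Rintegral_ge0 => x _; exact: sqr_ge0.
have mS : measurable_fun setT (fun x => \sum_(n <oo) (d n x)%:E)%E.
  by apply: ge0_emeasurable_sum => [n x _ _|n _]; [rewrite lee_fin|exact/measurable_EFinP].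
have S0 x : (0 <= \sum_(n <oo) (d n x)%:E)%E.
  by apply: nneseries_ge0 => n _ _; rewrite lee_fin.
have iS : mu.-integrable setT (fun x => \sum_(n <oo) (d n x)%:E)%E.
  apply/integrableP; split => //.
  under eq_integral do rewrite gee0_abs//.
  rewrite integral_nneseries//; last 2 first.
  - by move=> n; apply/measurable_EFinP; exact: md.
  - by move=> n x _; rewrite lee_fin.
  apply: (@le_lt_trans _ _ (2 * K)%:E); last exact: ltry.
  (* The terms K / 4^n are majorised by K / 2^n, whose sum is 2 K. *)
  apply: le_trans (@epsilon_trick0 R (2 * K) xpredT _); last by rewrite mulr_ge0.
  apply: lee_nneseries => [n _ _|n _].
    by apply: integral_ge0 => x _; rewrite lee_fin.
  have [i1 i2] := Ht n.
  rewrite -EFin_Rintegral; last exact: summable1Z.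
  rewrite lee_fin RintegralZl//.
  apply: (@le_trans _ _ (4 ^+ n * (K / 16 ^+ n))); first by rewrite ler_wpM2l.
  rewrite (_ : 4 ^+ n * (K / 16 ^+ n) = K * (4 ^+ n)^-1); last first.
    rewrite (_ : 16 = 4 * 4 :> R); last by ring.
    by rewrite exprMn; field; rewrite expf_neq0.
  rewrite natrX exprS (_ : 2 * K / (2 * 2 ^+ n) = K * (2 ^+ n)^-1); last first.
    by field; rewrite expf_neq0.
  rewrite ler_wpM2l// lef_pV2 ?posrE ?exprn_gt0//.
  by apply: lerXn2r; rewrite ?nnegrE// ler_nat.
have := integrable_ae measurableT iS.
apply: (@filterS _ _ (ae_filter_ringOfSetsType mu)) => x /(_ I) fx.
apply: (@cvg_of_geometric_sqr _ (fine (\sum_(n <oo) (d n x)%:E)%E)) => n.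
rewrite -lee_fin fineK//.
apply: le_trans (@nneseries_lim_ge _ _ xpredT 0%N n.+1 _); last by move=> m _ _;
  rewrite lee_fin.
rewrite big_nat_recr//= leeDr//.
by apply: sume_ge0 => m _; rewrite lee_fin.
Qed.

(** Convergence is needed only along r = 16^n: Fatou along that sequence, against a fixed T r, gives
    the rate K / r for every real r >= 1. *)
Lemma quantitative_riesz_fischer (T : R -> R -> R) (K : R) :
  (forall r, measurable_fun setT (T r)) ->
  (forall r s, 1 <= r -> r <= s -> summable1 (fun x => (T s x - T r x) ^+ 2) /\
     \int[mu]_x (T s x - T r x) ^+ 2 <= K / r) ->
  exists2 G : R -> R, measurable_fun setT G &
    forall r, 1 <= r -> summable1 (fun x => (G x - T r x) ^+ 2) /\
     \int[mu]_x (G x - T r x) ^+ 2 <= K / r.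
Proof.
move=> mT HT.
pose t n := T (16 ^+ n).
have le16 m n : (m <= n)%N -> (16 : R) ^+ m <= 16 ^+ n.
  by move=> mn; rewrite ler_weXn2l// ler1n.
have mt n : measurable_fun setT (t n) by exact: mT.
have : {ae mu, forall x, cvgn (t ^~ x)}.
  apply: (@ae_cvg_of_geometric_sqr _ K) => // n.
  by apply: HT; [rewrite -[leLHS](expr0 16); exact: le16|exact: le16].
(* The upper limit is measurable on the whole line and agrees with the limit wherever that
   exists. *)
pose G x := fine (limn_esup (fun n => (t n x)%:E)).
have mG : measurable_fun setT G.
  by apply: measurableT_comp => //; apply: measurable_fun_limn_esup => n;
    exact/measurable_EFinP.
move=> tG; exists G => // r r1.
have [N rN] : exists N : nat, r <= 16 ^+ N.
  exists (Num.bound r); apply: le_trans (ltW (archi_boundP _)) _; first exact: le_trans r1.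
  by rewrite -natrX ler_nat ltnW// ltn_expl.
(* The shift by [N] makes every index 16^(n + N) at least r, as the Cauchy bound requires. *)
apply: (@fatou_le (fun n x => (t (n + N)%N x - T r x) ^+ 2)).
- by move=> n; apply: measurable_funX; exact: measurable_funB.
- by move=> n x; exact: sqr_ge0.
- by apply: measurable_funX; exact: measurable_funB.
- by move=> x; exact: sqr_ge0.
- apply: (@filterS _ _ (ae_filter_ringOfSetsType mu) _ _ _ tG) => x /cvg_ex[l cl].
  have -> : G x = l.
    rewrite /G; have [_ ->] // : (limn_einf (EFin \o t ^~ x) = l%:E) * (limn_esup (EFin
      \o t ^~ x) = l%:E).
    by apply: cvg_limn_einf_sup; apply: cvg_EFin => //; exact: nearW.
  have cd : t (n + N)%N x - T r x @[n --> \oo] --> l - T r x.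
    by apply: cvgB; [rewrite (cvg_shiftn N (t ^~ x))|exact: cvg_cst].
  exact: (cvgM cd cd).
- move=> n; have [|i1 i2] := HT r (16 ^+ (n + N)) r1.
    by apply: (le_trans rN); apply: le16; rewrite leq_addl.
  by rewrite -EFin_Rintegral// lee_fin.
Qed.

(** * Integrability of the transform *)

Lemma Rintegral_trunc f r g : \int[mu]_x (trunc f r x * g x) = \int[mu]_(x in `[- r,
  r]) (f x * g x).
Proof.
rewrite [RHS]Rintegral_mkcond; apply: eq_Rintegral => x _.
by rewrite /trunc !patchE; case: ifP => //; rewrite mul0r.
Qed.

Lemma continuous_cosM (k : R) : continuous (fun y => cos (k * y)).
Proof.
by move=> y; apply: continuous_comp; [exact: mulrl_continuous|exact: continuous_cos].
Qed.

Lemma continuous_sinM (k : R) : continuous (fun y => sin (k * y)).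
Proof.
by move=> y; apply: continuous_comp; [exact: mulrl_continuous|exact: continuous_sin].
Qed.

Lemma continuous_mul f g : continuous f -> continuous g -> continuous (fun x => f x * g x).
Proof. by move=> cf cg x; apply: cvgM; [exact: cf|exact: cg]. Qed.

(** Integration by parts on [-r, r]: f(y) sin (k y) has derivative k f(y) cos (k y) + f1(y) sin (k
    y). The boundary term remains at finite r. *)
Lemma cos_transform_derive f f1 r k : 0 <= r -> (forall x : R, is_derive x 1 f (f1 x)) ->
  continuous f1 ->
  k * cos_transform (trunc f r) k =
  (f r + f (- r)) * sin (k * r) - sin_transform (trunc f1 r) k.
Proof.
move=> r0 df cf1; have cf := is_derive_continuous df.
rewrite /cos_transform /sin_transform !Rintegral_trunc.
have ic : mu.-integrable `[- r, r] (EFin \o (fun y => f y * cos (k * y))).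
  by apply: continuous_integrable_itv; apply: continuous_mul => //; exact: continuous_cosM.
have is1 : mu.-integrable `[- r, r] (EFin \o (fun y => f1 y * sin (k * y))).
  by apply: continuous_integrable_itv; apply: continuous_mul => //; exact: continuous_sinM.
rewrite -RintegralZl//; apply/eqP; rewrite eq_sym subr_eq; apply/eqP.
rewrite -RintegralD//; last first.
  apply: continuous_integrable_itv; apply: continuous_mul; first by move=> ?;
    exact: cvg_cst.
  by apply: continuous_mul => //; exact: continuous_cosM.
transitivity (f r * sin (k * r) - f (- r) * sin (k * - r)).
  by rewrite mulrN sinN; ring.
apply/esym; apply: (@Rintegral_FTC2 _ (fun y => f y * sin (k * y))).
- by rewrite ge0_cp.
- move=> y; apply: cvgD.
    apply: cvgM; first exact: cvg_cst.
    by apply: cvgM; [exact: cf|exact: continuous_cosM].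
  by apply: cvgM; [exact: cf1|exact: continuous_sinM].
- move=> y; have dfy := df y; apply: is_derive_eq; rewrite /GRing.scale/=; ring.
Qed.

Lemma sin_transform_derive f f1 r k : 0 <= r -> (forall x : R, is_derive x 1 f (f1 x)) ->
  continuous f1 ->
  k * sin_transform (trunc f r) k =
  (f (- r) - f r) * cos (k * r) + cos_transform (trunc f1 r) k.
Proof.
move=> r0 df cf1; have cf := is_derive_continuous df.
rewrite /cos_transform /sin_transform !Rintegral_trunc.
have ic : mu.-integrable `[- r, r] (EFin \o (fun y => f y * sin (k * y))).
  by apply: continuous_integrable_itv; apply: continuous_mul => //; exact: continuous_sinM.
have is1 : mu.-integrable `[- r, r] (EFin \o (fun y => f1 y * cos (k * y))).
  by apply: continuous_integrable_itv; apply: continuous_mul => //; exact: continuous_cosM.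
rewrite -RintegralZl//; apply/eqP; rewrite -subr_eq -opprB eqr_oppLR; apply/eqP.
rewrite -RintegralB//; last first.
  apply: continuous_integrable_itv; apply: continuous_mul; first by move=> ?;
    exact: cvg_cst.
  by apply: continuous_mul => //; exact: continuous_sinM.
transitivity (f r * cos (k * r) - f (- r) * cos (k * - r)); last first.
  by rewrite mulrN cosN; ring.
apply: (@Rintegral_FTC2 _ (fun y => f y * cos (k * y))).
- by rewrite ge0_cp.
- move=> y; apply: cvgB.
    by apply: cvgM; [exact: cf1|exact: continuous_cosM].
  apply: cvgM; first exact: cvg_cst.
  by apply: cvgM; [exact: cf|exact: continuous_sinM].
- move=> y; have dfy := df y; apply: is_derive_eq; rewrite /GRing.scale/=; ring.
Qed.

Lemma decays_endpoint_le f C M r : decays f C M -> 1 < r ->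
  `|f r| + `|f (- r)| <= 2 * C / r.
Proof.
move=> [_ C0 _ fC] r1; have r0 : 0 < r by exact: lt_trans r1.
have := fC r; have := fC (- r); rewrite normrN (gtr0_norm r0) => /(_ r1) h1 /(_ r1) h2.
by rewrite mulrDl mul1r mulrDl lerD.
Qed.

(** Each boundary term is at most 2 C / r, uniformly in k, and (p + q)^2 <= 2 p^2 + 2 q^2 separates
    it from the transform of [f1]. *)
Lemma sqr_transform_derive_le f f1 C M r k : decays f C M -> 1 < r ->
  (forall x : R, is_derive x 1 f (f1 x)) -> continuous f1 ->
  k ^+ 2 * (cos_transform (trunc f r) k ^+ 2 + sin_transform (trunc f r) k ^+ 2) <=
  2 * (cos_transform (trunc f1 r) k ^+ 2 + sin_transform (trunc f1 r) k ^+ 2) +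
  4 * (2 * C / r) ^+ 2.
Proof.
move=> df r1 ddf cf1; have r0 : 0 <= r by rewrite ltW// (lt_trans _ r1).
have E := decays_endpoint_le df r1.
rewrite mulrDr -!exprMn (cos_transform_derive k r0 ddf cf1) (sin_transform_derive k r0
  ddf cf1).
set c := cos_transform _ _; set s := sin_transform _ _; set B := 2 * C / r in E *.
have h1 : `|(f r + f (- r)) * sin (k * r)| <= B.
  by rewrite normrM -[leRHS]mulr1 ler_pM// ?sin_max//; apply: le_trans (ler_normD _ _) E.
have h2 : `|(f (- r) - f r) * cos (k * r)| <= B.
  by rewrite normrM -[leRHS]mulr1 ler_pM// ?cos_max//; apply: le_trans (ler_normB _ _) _;
    rewrite addrC.
set p := (_ * sin _) in h1 *; set q := (_ * cos _) in h2 *.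
have p2 : p ^+ 2 <= B ^+ 2 by rewrite -(real_normK (num_real p)) lerXn2r ?nnegrE//
  (le_trans _ h1).
have q2 : q ^+ 2 <= B ^+ 2 by rewrite -(real_normK (num_real q)) lerXn2r ?nnegrE//
  (le_trans _ h1).
have := sqr_ge0 (p + s); have := sqr_ge0 (q - c); nra.
Qed.

(* a and b stand for sqrt (2 pi) Re (F f) and - sqrt (2 pi) Im (F f). *)
Definition transform_limit f (a b : R -> R) := forall t : R, 0 < t -> exists r0 : R,
  forall r, r0 <= r ->
  summable1 (fun k => (a k - cos_transform (trunc f r) k) ^+ 2 +
                      (b k - sin_transform (trunc f r) k) ^+ 2) /\
  \int[mu]_k ((a k - cos_transform (trunc f r) k) ^+ 2 +
              (b k - sin_transform (trunc f r) k) ^+ 2) <= t.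

Lemma measurable_trunc f r : measurable_fun setT f -> measurable_fun setT (trunc f r).
Proof.
by move=> mf; apply/(measurable_restrictT _ _).1 => //; exact: measurable_funTS mf.
Qed.

Lemma Rintegral_trunc_cst (r : R) : 0 <= r -> \int[mu]_x trunc (cst 1) r x = 2 * r.
Proof.
move=> r0; rewrite -Rintegral_mkcond (_ : 2 * r = r - - r); last by ring.
apply: (@Rintegral_FTC2 (cst 1) id) => [|x]; first by rewrite ge0_cp.
exact: cvg_cst.
Qed.

(** From a^2 <= 2 (a - A)^2 + 2 A^2. The factor x = k^2 is replaced by its bound N only on the
    difference, which can be made small; on A and B it is absorbed by the hypothesis. *)
Lemma sqr_bound_shift (x N a b A B E z : R) : 0 <= x -> x <= N ->
  x * (A ^+ 2 + B ^+ 2) <= 2 * E + 4 * z ->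
  x * (a ^+ 2 + b ^+ 2) <= 2 * N * ((a - A) ^+ 2 + (b - B) ^+ 2) + 4 * E + 8 * z.
Proof.
move=> x0 xN h.
have h1 : x * (a ^+ 2 + b ^+ 2) <=
    x * (2 * ((a - A) ^+ 2 + (b - B) ^+ 2) + 2 * (A ^+ 2 + B ^+ 2)).
  apply: ler_wpM2l => //.
  have := sqr_ge0 (a - A - A); have := sqr_ge0 (b - B - B); lra.
have h2 : x * (2 * ((a - A) ^+ 2 + (b - B) ^+ 2)) <= N * (2 * ((a - A) ^+ 2 + (b - B) ^+
  2)).
  by rewrite ler_wpM2r ?mulr_ge0 ?addr_ge0 ?sqr_ge0.
lra.
Qed.

(** The boundary terms are constant in size over k, so they are integrable only over a bounded
    window |k| <= n. For each n the radius r is chosen large enough to give a bound [K] free of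
    n. *)
Lemma summable1_freq_sqr f f1 (C M C1 M1 : R) (a b : R -> R) :
  decays f C M -> decays f1 C1 M1 -> (forall x : R, is_derive x 1 f (f1 x)) ->
  measurable_fun setT a -> measurable_fun setT b -> transform_limit f a b ->
  summable1 (fun k => k ^+ 2 * (a k ^+ 2 + b k ^+ 2)).
Proof.
move=> df df1 ddf ma mb lim; have [_ C0 _ _] := df; have [cf1 _ _ _] := df1.
set G := (fun k => _).
have mG : measurable_fun setT G.
  apply: measurable_funM; first exact: measurable_funX.
  by apply: measurable_funD; apply: measurable_funX.
have G0 x : 0 <= G x by rewrite mulr_ge0 ?addr_ge0 ?sqr_ge0.
(* In this order: the distance to the truncated transform, the transform of [f1], and the boundary
   terms over a window of length 2 n, namely 64 C^2 n / r^2. *)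
pose K := 2 + 4 * ((2 * pi) ^+ 2 * (C1 ^+ 2 + M1 ^+ 2)) + 64 * C ^+ 2.
suff : summable1 G /\ \int[mu]_x G x <= K by case.
apply: (@fatou_le (fun n => trunc G n%:R)) => //.
- by move=> n; exact: measurable_trunc.
- by move=> n x; rewrite truncE; case: ifP.
- apply: aeW => x; apply: cvg_near_cst; exists (Num.bound `|x|) => // n /= xn.
  rewrite truncE ifT//.
  by apply: le_trans (ltW (archi_boundP (normr_ge0 x))) _; rewrite ler_nat.
move=> n.
(* On the window k^2 is at most (n + 1)^2, so this tolerance keeps the distance term at most 2; n +
   1 avoids a division by 0 at n = 0. *)
have t0 : (0 : R) < (n.+1%:R ^+ 2)^-1 by rewrite invr_gt0 exprn_gt0.
have [r0 Hr] := lim _ t0.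
(* [n.+2] ensures 1 < r, also for n = 0, and n <= r <= r^2. *)
pose r := Num.max r0 n.+2%:R.
have nr : n.+2%:R <= r by rewrite /r le_max lexx orbT.
have r0r : r0 <= r by rewrite /r le_max lexx.
have [iD lD] := Hr r r0r.
have r1 : 1 < r by apply: lt_le_trans nr; rewrite ltr1n.
have [iE lE] := transform_trunc_le r df1.
have i1 : summable1 (trunc (cst 1) n%:R) by apply: summable1_trunc => x; exact: cvg_cst.
have iB := summable1D (summable1D (summable1Z (2 * n.+1%:R ^+ 2) iD) (summable1Z 4 iE))
  (summable1Z (8 * (2 * C / r) ^+ 2) i1).
apply: (@le_trans _ _ (\int[mu]_x (2 * n.+1%:R ^+ 2 *
   ((a x - cos_transform (trunc f r) x) ^+ 2 + (b x - sin_transform (trunc f r) x) ^+ 2) +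
   4 * (cos_transform (trunc f1 r) x ^+ 2 + sin_transform (trunc f1 r) x ^+ 2) +
   8 * (2 * C / r) ^+ 2 * trunc (cst 1) n%:R x)%:E)%E).
  apply: ge0_le_integral => //.
  - by move=> x _; rewrite lee_fin truncE; case: ifP.
  - by apply/measurable_EFinP; exact: measurable_trunc.
  - by apply/measurable_EFinP; exact: summable1_measurable iB.
  - move=> x _; rewrite lee_fin !truncE; case: ifPn => [xn|_]; last first.
      by rewrite mulr0 addr0 addr_ge0 ?mulr_ge0 ?addr_ge0 ?sqr_ge0.
    have := sqr_transform_derive_le x df r1 ddf cf1.
    have x2 : x ^+ 2 <= n.+1%:R ^+ 2.
      rewrite -(real_normK (num_real x)) lerXn2r ?nnegrE// (le_trans xn)// ler_nat//.
    rewrite /G mulr1.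
    by apply: sqr_bound_shift; [exact: sqr_ge0|exact: x2].
rewrite -EFin_Rintegral// lee_fin.
rewrite RintegralD//; [|by apply: summable1D; exact: summable1Z|exact: summable1Z].
rewrite RintegralD//; [|exact: summable1Z|exact: summable1Z].
rewrite (RintegralZl _ measurableT iD) (RintegralZl _ measurableT iE) (RintegralZl _
  measurableT i1).
rewrite Rintegral_trunc_cst// /K; apply: lerD; first apply: lerD.
- rewrite -[leRHS]mulr1 -mulrA ler_wpM2l//.
  by rewrite mulrC -ler_pdivlMr ?exprn_gt0// div1r.
- by rewrite ler_wpM2l.
- have r00 : 0 < r by exact: lt_trans r1.
  have nr' : n%:R <= r by apply: le_trans nr; rewrite ler_nat; do 2 apply: leqW.
  rewrite (_ : 8 * (2 * C / r) ^+ 2 * (2 * n%:R) = 64 * C ^+ 2 * (n%:R / r ^+ 2));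
    last first.
    by field; rewrite gt_eqF.
  rewrite ler_piMr ?(mulr_ge0 _ (sqr_ge0 C))// ler_pdivrMr ?exprn_gt0// mul1r.
  by apply: (le_trans nr'); rewrite expr2 ler_peMr// ltW.
Qed.

(** Here c stands for b^2: the majorant is then symmetric in a and b and serves both parts of the
    transform. *)
Lemma ler_norm_freq (k a c : R) : 0 <= c ->
  `|a| <= 2^-1 * poisson 1 k + 2^-1 * ((a ^+ 2 + c) + k ^+ 2 * (a ^+ 2 + c)).
Proof.
move=> c0; have k1 : 0 < 1 + k ^+ 2 by rewrite ltr_pwDl ?sqr_ge0.
have p0 : 0 < (1 + k ^+ 2)^-1 by rewrite invr_gt0.
rewrite /poisson expr1n mulr1.
(* AM-GM: [|a| <= q + d |a|^2 / 4] whenever [d q = 1]. *)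
have h : `|a| <= (1 + k ^+ 2)^-1 + (1 + k ^+ 2) / 4 * `|a| ^+ 2.
  have := sqr_ge0 ((1 + k ^+ 2)^-1 - `|a| / 2); have := mulfV (lt0r_neq0 k1).
  set q := _^-1 in p0 *; set d := 1 + k ^+ 2 in k1 p0 *; move=> dq h.
  have : 0 <= d * (q - `|a| / 2) ^+ 2 by rewrite mulr_ge0// ltW.
  rewrite (_ : d * (q - `|a| / 2) ^+ 2 = (d * q) * q - (d * q) * `|a| + d / 4 * `|a| ^+
    2); last by field.
  rewrite dq; lra.
rewrite real_normK ?num_real// in h.
apply: (le_trans h); have a2 := sqr_ge0 a; have k2 := sqr_ge0 k.
set q := _^-1; rewrite (_ : 2^-1 * (2 * q) = q); last by field.
rewrite lerD2l; nra.
Qed.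

Lemma transform_limit_summable f f1 (C M C1 M1 : R) (a b : R -> R) :
  decays f C M -> decays f1 C1 M1 -> (forall x : R, is_derive x 1 f (f1 x)) ->
  measurable_fun setT a -> measurable_fun setT b -> transform_limit f a b ->
  summable1 a /\ summable1 b.
Proof.
move=> df df1 ddf ma mb lim.
have i2 := summable1_freq_sqr df df1 ddf ma mb lim.
(* A single truncation at squared distance at most 1 suffices, its own transform being square
   integrable by Plancherel. *)
have i1 : summable1 (fun k => a k ^+ 2 + b k ^+ 2).
  have [r Hr] := lim 1 ltr01; have [iD _] := Hr r (lexx r).
  have [iE _] := transform_trunc_le r df.
  apply: summable1_le (summable1D (summable1Z 2 iD) (summable1Z 4 iE)).
    by apply: measurable_funD; apply: measurable_funX.
  move=> k; rewrite ger0_norm ?addr_ge0 ?sqr_ge0//.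
  set A := cos_transform _ _; set B := sin_transform _ _.
  have := @sqr_bound_shift 1 1 (a k) (b k) A B (A ^+ 2 + B ^+ 2) 0.
  rewrite !mul1r !mulr0 !addr0 mulr1; apply => //.
  by rewrite ler_peMl ?addr_ge0 ?sqr_ge0// ler1n.
have iP : summable1 (poisson 1).
  by have := summable1_poisson 0 ltr01; under eq_fun do rewrite subr0.
have iB := summable1D (summable1Z 2^-1 iP) (summable1Z 2^-1 (summable1D i1 i2)).
split; apply: summable1_le iB => // k; first exact: ler_norm_freq (sqr_ge0 _).
by rewrite addrC [a k ^+ 2 + _]addrC; rewrite addrC; exact: ler_norm_freq (sqr_ge0 _).
Qed.

(** * Inversion *)

(** Cauchy-Schwarz against the weight in AM-GM form: w |u| <= t w^2 / 2 + u^2 / (2 t), with t of the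
    size of the L^2 distance. As 0 <= w <= 1, w^2 is replaced by w. *)
Lemma weighted_pairing_le e t (a b A B p q : R -> R) : 0 < e -> 0 < t ->
  measurable_fun setT p -> measurable_fun setT q ->
  (forall k, `|p k| <= 1) -> (forall k, `|q k| <= 1) ->
  summable1 (fun k => weight e k * (a k * p k + b k * q k)) ->
  summable1 (fun k => weight e k * (A k * p k + B k * q k)) ->
  summable1 (fun k => (a k - A k) ^+ 2 + (b k - B k) ^+ 2) ->
  \int[mu]_k ((a k - A k) ^+ 2 + (b k - B k) ^+ 2) <= 2 * t ^+ 2 ->
  `|\int[mu]_k (weight e k * (a k * p k + b k * q k)) -
    \int[mu]_k (weight e k * (A k * p k + B k * q k))| <= t * (\int[mu]_k weight e k + 1).
Proof.
move=> e0 t0 mp mq p1 q1 ia iA iD lD.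
rewrite -RintegralB//.
have iw := summable1_weight e0.
have iR := summable1D (summable1Z t iw) (summable1Z (2 * t)^-1 iD).
apply: (@le_trans _ _ (\int[mu]_k (t * weight e k +
    (2 * t)^-1 * ((a k - A k) ^+ 2 + (b k - B k) ^+ 2)))).
  apply: ler_norm_Rintegral => //.
    by apply: measurable_funB; exact: summable1_measurable.
  move=> k; rewrite -mulrBr normrM (ger0_norm (weight_ge0 e k)).
  have w0 := weight_ge0 e k; have w1 := weight_le1 k (ltW e0).
  rewrite (_ : _ - _ = (a k - A k) * p k + (b k - B k) * q k); last by ring.
  apply: (@le_trans _ _ (weight e k * (`|a k - A k| + `|b k - B k|))).
    rewrite ler_wpM2l//; apply: le_trans (ler_normD _ _) _.
    by rewrite !normrM lerD// ler_piMr.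
  rewrite -(real_normK (num_real (a k - A k))) -(real_normK (num_real (b k - B k))).
  set u := `|a k - A k|; set v := `|b k - B k|; set w := weight e k in w0 w1 *.
  rewrite -(ler_pM2l (_ : 0 < 2 * t)); last by rewrite mulr_gt0.
  rewrite [leRHS](_ : _ = 2 * t ^+ 2 * w + (u ^+ 2 + v ^+ 2)); last by field;
    rewrite gt_eqF.
  have h1 := sqr_ge0 (t * w - u); have h2 := sqr_ge0 (t * w - v).
  have h3 : 2 * (t * w) ^+ 2 <= 2 * t ^+ 2 * w.
    rewrite exprMn mulrA ler_wpM2l// ?mulr_ge0 ?(ltW t0)// expr2 ler_piMl//.
  nra.
rewrite RintegralD//; [|exact: summable1Z|exact: summable1Z].
rewrite (RintegralZl _ measurableT iw) (RintegralZl _ measurableT iD) mulrDr lerD// mulr1.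
rewrite mulrC ler_pdivrMr ?mulr_gt0//; apply: (le_trans lD).
by rewrite expr2 mulrCA.
Qed.

(** For |u| >= d one has 1 + u^2 <= (1 + 1 / d^2) u^2, so away from its centre the kernel is O(e)
    times the fixed integrable kernel P_1. *)
Lemma poisson_le_far e d u : 0 < e -> 0 < d -> d <= `|u| ->
  poisson e u <= e * (1 + d ^- 2) * poisson 1 u.
Proof.
move=> e0 d0 du; rewrite /poisson expr1n mulr1.
have d2 : 0 < d ^+ 2 by rewrite exprn_gt0.
have u2 : d ^+ 2 <= u ^+ 2.
  by rewrite -(real_normK (num_real u)) lerXn2r ?nnegrE// ltW.
have u20 : 0 < u ^+ 2 by exact: lt_le_trans u2.
have e2 : 0 <= e ^+ 2 by exact: sqr_ge0.
rewrite -mulrA [leRHS](_ : _ = 2 * (e * ((1 + d ^- 2) / (1 + u ^+ 2)))); last by ring.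
rewrite ler_wpM2l// ler_wpM2l//; first exact: ltW.
rewrite ler_pdivlMr ?addr_gt0// mulrC ler_pdivrMr ?ltr_wpDl//.
have h : u ^+ 2 * d ^- 2 >= 1 by rewrite ler_pdivlMr// mul1r.
have i0 : 0 < d ^- 2 by rewrite invr_gt0.
nra.
Qed.

(** The kernel is an approximate identity of mass 2 pi: near x continuity gives eta, and far from x
    the difference is at most 2 M while the kernel is O(e). [K] depends on neither e nor r, which
    matters because r will be chosen after e. *)
Lemma poisson_trunc_close f (C M : R) x eta : decays f C M -> 0 < eta ->
  exists K : R, forall e r, 0 < e -> `|x| + 1 <= r ->
  `|\int[mu]_z (trunc f r z * poisson e (z - x)) - 2 * pi * f x| <= 2 * pi * eta + K * e.
Proof.
move=> [cf _ fM _] eta0.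
have := cf x => /cvgrPdist_le /(_ _ eta0) /nbhs_ballP[d /= d0 Hd].
(* The cap at 1 keeps the points near x inside [-r, r], where the truncation equals f, as soon as
   |x| + 1 <= r. *)
pose d1 := Num.min d 1.
have d10 : 0 < d1 by rewrite lt_min d0 ltr01.
exists (2 * M * (1 + d1 ^- 2) * (2 * pi)) => e r e0 xr.
have M0 : 0 <= M by exact: le_trans (fM 0).
have c0 : 0 <= 2 * M * (e * (1 + d1 ^- 2)).
  apply: mulr_ge0; first exact: mulr_ge0.
  by rewrite mulr_ge0 ?(ltW e0)// addr_ge0// invr_ge0 exprn_ge0// ltW.
have iP := summable1_poisson x e0; have iP1 := summable1_poisson x ltr01.
have iT := summable1M_poisson x e0 (summable1_trunc r cf).
have -> : \int[mu]_z (trunc f r z * poisson e (z - x)) - 2 * pi * f x =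
    \int[mu]_z (trunc f r z * poisson e (z - x) - f x * poisson e (z - x)).
  rewrite RintegralB//; last exact: summable1Z.
  by rewrite (RintegralZl _ measurableT iP) Rintegral_poisson// [_ * f x]mulrC.
have -> : 2 * pi * eta + 2 * M * (1 + d1 ^- 2) * (2 * pi) * e =
    \int[mu]_z (eta * poisson e (z - x) + 2 * M * (e * (1 + d1 ^- 2)) * poisson 1 (z - x)).
  rewrite RintegralD//; [|exact: summable1Z|exact: summable1Z].
  rewrite (RintegralZl _ measurableT iP) (RintegralZl _ measurableT iP1)
    !Rintegral_poisson//.
  ring.
apply: ler_norm_Rintegral; last by apply: summable1D; exact: summable1Z.
  by apply: summable1_measurable; apply: summable1B => //; exact: summable1Z.
move=> z; rewrite -mulrBl normrM (ger0_norm (poisson_ge0 _ e0)).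
have [zx|zx] := ltP `|z - x| d1.
  apply: ler_wpDr; first by rewrite (mulr_ge0 c0)// poisson_ge0.
  rewrite ler_wpM2r ?poisson_ge0// truncE ifT; last first.
    apply: le_trans xr; rewrite -[z](subrK x) addrC; apply: le_trans (ler_normD _ _) _.
    by rewrite lerD2l (le_trans (ltW zx))// /d1 ge_min lexx orbT.
  rewrite distrC; apply: Hd; rewrite /ball/= distrC (lt_le_trans zx)// /d1 ge_min lexx//.
apply: ler_wpDl; first by rewrite mulr_ge0 ?poisson_ge0// ltW.
rewrite -mulrA; apply: ler_pM => //; first exact: poisson_ge0.
  have -> : 2 * M = M + M by ring.
  apply: le_trans (ler_normB _ _) _; rewrite lerD// truncE; case: ifP => // _.
  by rewrite normr0.
exact: poisson_le_far.
Qed.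

(** Abel summation gives back the integral of an integrable function, by dominated convergence. *)
Lemma cvg_weighted_Rintegral (g G : R -> R) : measurable_fun setT g -> (forall k,
  `|g k| <= G k) ->
  summable1 G ->
  \int[mu]_k (weight n.+1%:R^-1 k * g k) @[n --> \oo] --> \int[mu]_k g k.
Proof.
move=> mg gG iG; apply: (@cvg_Rintegral _ _ G) => //.
- by move=> n; apply: measurable_funM => //; exact: measurable_weight.
- move=> n k; rewrite normrM (ger0_norm (weight_ge0 _ _)); apply: le_trans (gG k).
  by rewrite ler_piMl// weight_le1// invr_ge0.
- move=> k; rewrite -[X in _ --> X]mul1r; apply: cvgM; first exact: cvg_weight.
  exact: cvg_cst.
Qed.

Lemma summable1_weighted_pairing e (a b p q : R -> R) : 0 < e -> summable1 a ->
  summable1 b ->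
  measurable_fun setT p -> measurable_fun setT q ->
  (forall k, `|p k| <= 1) -> (forall k, `|q k| <= 1) ->
  summable1 (fun k => weight e k * (a k * p k + b k * q k)).
Proof.
move=> e0 ia ib mp mq p1 q1.
have := summable1D (summable1M mp p1 ia) (summable1M mq q1 ib).
move=> /(summable1M (measurable_weight e) (M := 1)) h.
have {}h : summable1 (fun k => (a k * p k + b k * q k) * weight e k).
  by apply: h => k; rewrite ger0_norm ?weight_ge0// weight_le1// ltW.
by move: h; under eq_fun do rewrite mulrC.
Qed.

(** The tolerance is the parameter [e] of the weight itself, so that one limit e -> 0 removes the
    weight and the truncation error together. *)
Lemma transform_limit_weighted f (a b : R -> R) (p q : R -> R) e s :
  continuous f -> summable1 a -> summable1 b -> transform_limit f a b ->
  measurable_fun setT p -> measurable_fun setT q ->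
  (forall k, `|p k| <= 1) -> (forall k, `|q k| <= 1) -> 0 < e ->
  exists2 r, s <= r &
  `|\int[mu]_k (weight e k * (a k * p k + b k * q k)) -
    \int[mu]_k (weight e k * (cos_transform (trunc f r) k * p k +
                              sin_transform (trunc f r) k * q k))| <= e.
Proof.
move=> cf ia ib lim mp mq p1 q1 e0.
set W := \int[mu]_k weight e k.
have W1 : 0 < W + 1 by rewrite ltr_wpDl// Rintegral_ge0// => k _; exact: weight_ge0.
have t0 : 0 < e / (W + 1) by rewrite divr_gt0.
(* With t = e / (W + 1) the bound t (W + 1) of [weighted_pairing_le] is exactly [e]. *)
have [|r0 Hr] := lim (2 * (e / (W + 1)) ^+ 2); first by rewrite mulr_gt0// exprn_gt0.
exists (Num.max r0 s); first by rewrite le_max lexx orbT.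
set r := Num.max _ _; have [|iD lD] := Hr r; first by rewrite le_max lexx.
have ih := summable1_trunc r cf.
rewrite -[X in _ <= X](divfK (lt0r_neq0 W1)).
apply: weighted_pairing_le => //; first exact: summable1_weighted_pairing.
apply: (@summable1_weightM _ _ (2 * \int[mu]_y `|trunc f r y|)) => //.
  apply: measurable_funD; apply: measurable_funM => //.
    exact: measurable_cos_transform.
  exact: measurable_sin_transform.
move=> k; apply: le_trans (ler_normD _ _) _; rewrite !normrM mulrDl mul1r lerD//.
  by rewrite -[leRHS]mulr1 ler_pM// cos_transform_le.
by rewrite -[leRHS]mulr1 ler_pM// sin_transform_le.
Qed.

Lemma transform_inversion f f1 (C M C1 M1 : R) (a b : R -> R) x :
  decays f C M -> decays f1 C1 M1 -> (forall x : R, is_derive x 1 f (f1 x)) ->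
  measurable_fun setT a -> measurable_fun setT b -> transform_limit f a b ->
  \int[mu]_k (a k * cos (k * x) + b k * sin (k * x)) = 2 * pi * f x /\
  \int[mu]_k (b k * cos (k * x) - a k * sin (k * x)) = 0.
Proof.
move=> df df1 ddf ma mb lim; have [cf _ _ _] := df.
have [ia ib] := transform_limit_summable df df1 ddf ma mb lim.
have iab := summable1D (integrable_norm ia) (integrable_norm ib).
have mc := measurable_cosZ x; have ms := measurable_sinZ x.
have c1 k : `|cos (k * x)| <= 1 by exact: cos_max.
have s1 k : `|sin (k * x)| <= 1 by exact: sin_max.
have mNs : measurable_fun setT (fun k => - sin (k * x)) by exact: measurableT_comp.
have Ns1 k : `|- sin (k * x)| <= 1 by rewrite normrN.
split.
  have h := @cvg_weighted_Rintegral (fun k => a k * cos (k * x) + b k * sin (k * x)) _ _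
    _ iab.
  apply: (cvg_unique (@Rhausdorff R) (h _ _)).
  - by apply: measurable_funD; exact: measurable_funM.
  - move=> k; apply: le_trans (ler_normD _ _) _.
    by rewrite !normrM lerD// ler_piMr.
  apply/cvgrPdist_le => eps eps0.
  (* This eta costs eps / 2 in [poisson_trunc_close]. The other half of eps covers (|K| + 1) e: K e
     from the kernel and e from the truncation. *)
  have eta0 : 0 < eps / 2 / (2 * pi) by rewrite !divr_gt0// mulr_gt0// pi_gt0.
  have [K HK] := poisson_trunc_close x df eta0.
  have : (`|K| + 1) * n.+1%:R^-1 @[n --> \oo] --> (0 : R).
    by rewrite -(mulr0 (`|K| + 1)); apply: cvgM; [exact: cvg_cst|exact: cvg_harmonic].
  move=> /cvgrPdist_le /(_ (eps / 2)); rewrite divr_gt0// => /(_ isT).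
  apply: filterS => n; rewrite sub0r normrN => Hn.
  set e := n.+1%:R^-1 in Hn *; have e0 : 0 < e by rewrite invr_gt0.
  have [r xr Hr] := transform_limit_weighted (`|x| + 1) cf ia ib lim mc ms c1 s1 e0.
  rewrite weighted_cos_inversion// in Hr; last exact: summable1_trunc.
  have := HK e r e0 xr.
  rewrite (_ : 2 * pi * (eps / 2 / (2 * pi)) = eps / 2); last by rewrite mulrC divfK//
    gt_eqF// mulr_gt0// pi_gt0.
  set I := \int[mu]_k _ in Hr *; set J := \int[mu]_z _ in Hr *; move=> HJ.
  rewrite distrC (_ : I - _ = (I - J) + (J - 2 * pi * f x)); last by ring.
  apply: le_trans (ler_normD _ _) _; apply: le_trans (lerD Hr HJ) _.
  have Ke : K * e <= `|K| * e by rewrite ler_wpM2r ?ler_norm// ltW.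
  have := le_trans (ler_norm _) Hn; lra.
have h := @cvg_weighted_Rintegral (fun k => b k * cos (k * x) - a k * sin (k * x)) _ _ _
  iab.
apply: (cvg_unique (@Rhausdorff R) (h _ _)).
- by apply: measurable_funB; exact: measurable_funM.
- move=> k; apply: le_trans (ler_normB _ _) _.
  by rewrite !normrM addrC lerD// ler_piMr.
apply/cvgrPdist_le => eps eps0.
have := @cvg_harmonic R => /cvgrPdist_le /(_ _ eps0).
apply: filterS => n; rewrite !sub0r !normrN => Hn.
set e := n.+1%:R^-1 in Hn *; have e0 : 0 < e by rewrite invr_gt0.
(* Pairing with - sin and cos gives the imaginary part; its truncated version is exactly 0, so only
   the error [e] is left. *)
have [r _ Hr] := transform_limit_weighted 0 cf ia ib lim mNs mc Ns1 c1 e0.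
move: Hr; rewrite [X in _ - X](_ : _ = 0); last first.
  rewrite -(@weighted_sin_inversion e (trunc f r) x e0); last exact: summable1_trunc.
  by apply: eq_Rintegral => k _; congr (_ * _); ring.
rewrite subr0 => Hr; apply: le_trans (le_trans (ler_norm _) Hn).
rewrite (_ : \int[mu]_k _ = \int[mu]_k (weight e k * (a k * - sin (k * x) + b k * cos (k
  * x))))//.
by apply: eq_Rintegral => k _; congr (_ * _); ring.
Qed.

(** Each of the two transforms inherits the Cauchy bound on the sum of squares; the limits are taken
    separately, whence the factor 2. *)
Lemma transform_limit_exists f (C M : R) : decays f C M ->
  exists a b : R -> R, [/\ measurable_fun setT a, measurable_fun setT b &
    forall r, 1 <= r ->
    summable1 (fun k => (a k - cos_transform (trunc f r) k) ^+ 2 +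
                        (b k - sin_transform (trunc f r) k) ^+ 2) /\
    \int[mu]_k ((a k - cos_transform (trunc f r) k) ^+ 2 +
                (b k - sin_transform (trunc f r) k) ^+ 2) <= 2 * (2 * pi * C) ^+ 2 / r].
Proof.
move=> df; have [cf _ _ _] := df.
have mC r := measurable_cos_transform (summable1_trunc r cf).
have mS r := measurable_sin_transform (summable1_trunc r cf).
have [|a ma Ha] := @quantitative_riesz_fischer (fun r => cos_transform (trunc f r)) ((2 *
  pi * C) ^+ 2) mC.
  move=> r s r1 rs; have [i l] := transform_truncB_le df r1 rs.
  have iC : summable1 (fun k => (cos_transform (trunc f s) k - cos_transform (trunc f r)
    k) ^+ 2).
    apply: summable1_le i; first by apply: measurable_funX; exact: measurable_funB.
    by move=> k; rewrite ger0_norm ?sqr_ge0// lerDl sqr_ge0.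
  split => //; apply: le_trans l; apply: le_Rintegral => // k _.
  by rewrite lerDl sqr_ge0.
have [|b mb Hb] := @quantitative_riesz_fischer (fun r => sin_transform (trunc f r)) ((2 *
  pi * C) ^+ 2) mS.
  move=> r s r1 rs; have [i l] := transform_truncB_le df r1 rs.
  have iS : summable1 (fun k => (sin_transform (trunc f s) k - sin_transform (trunc f r)
    k) ^+ 2).
    apply: summable1_le i; first by apply: measurable_funX; exact: measurable_funB.
    by move=> k; rewrite ger0_norm ?sqr_ge0// lerDr sqr_ge0.
  split => //; apply: le_trans l; apply: le_Rintegral => // k _.
  by rewrite lerDr sqr_ge0.
exists a, b; split => // r r1; have [i1 l1] := Ha r r1; have [i2 l2] := Hb r r1.
split; first exact: summable1D.
by rewrite RintegralD// (le_trans (lerD l1 l2))//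
  [leRHS](_ : _ = (2 * pi * C) ^+ 2 / r + (2 * pi * C) ^+ 2 / r)//; ring.
Qed.

(** * Complex-valued transforms *)

Definition fourier_cst : R := (Num.sqrt (2 * pi))^-1.
Local Notation c := fourier_cst.

Lemma fourier_cst_gt0 : 0 < c.
Proof. by rewrite invr_gt0 sqrtr_gt0 mulr_gt0// pi_gt0. Qed.

Lemma sqr_fourier_cst : c ^+ 2 = (2 * pi)^-1.
Proof. by rewrite exprVn sqr_sqrtr// mulr_ge0// pi_ge0. Qed.

Lemma trunc_fourierE f r k : continuous f ->
  trunc_fourier f r k = (c * cos_transform (trunc f r) k) +i* - (c * sin_transform (trunc
    f r) k).
Proof.
move=> cf; rewrite /trunc_fourier /Cintegral /= /cos_transform /sin_transform
  !Rintegral_trunc.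
have -> : \int[mu]_(x in `[- r, r]) (f x * cos (- (k * x)) - 0 * sin (- (k * x))) =
    \int[mu]_(x in `[- r, r]) (f x * cos (k * x)).
  by apply: eq_Rintegral => x _; rewrite cosN mul0r subr0.
have -> : \int[mu]_(x in `[- r, r]) (f x * sin (- (k * x)) + 0 * cos (- (k * x))) =
    - \int[mu]_(x in `[- r, r]) (f x * sin (k * x)).
  have i : mu.-integrable `[- r, r] (EFin \o (fun y => f y * sin (k * y))).
    by apply: continuous_integrable_itv; apply: continuous_mul => //;
      exact: continuous_sinM.
  transitivity (\int[mu]_(x in `[- r, r]) (-1 * (f x * sin (k * x)))).
    by apply: eq_Rintegral => x _; rewrite sinN mul0r addr0; ring.
  by rewrite RintegralZl// mulN1r.
by apply/eqP; rewrite eq_complex /= !mul0r subr0 addr0 mulrN !eqxx.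
Qed.

Lemma inverse_fourierE (F : R -> R[i]) x :
  inverse_fourier F x =
   (c * \int[mu]_k (complex.Re (F k) * cos (k * x) - complex.Im (F k) * sin (k * x))) +i*
   (c * \int[mu]_k (complex.Re (F k) * sin (k * x) + complex.Im (F k) * cos (k * x))).
Proof.
rewrite /inverse_fourier /Cintegral.
have -> : \int[mu]_k complex.Re (F k * expi (k * x)) =
    \int[mu]_k (complex.Re (F k) * cos (k * x) - complex.Im (F k) * sin (k * x)).
  by apply: eq_Rintegral => k _; case: (F k).
have -> : \int[mu]_k complex.Im (F k * expi (k * x)) =
    \int[mu]_k (complex.Re (F k) * sin (k * x) + complex.Im (F k) * cos (k * x)).
  by apply: eq_Rintegral => k _; case: (F k).
by apply/eqP; rewrite eq_complex /= !mul0r subr0 addr0 !eqxx.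
Qed.

Lemma L2distE (F G : R -> R[i]) : L2dist F G =
  ((\int[mu]_k ((complex.Re (F k) - complex.Re (G k)) ^+ 2 +
                (complex.Im (F k) - complex.Im (G k)) ^+ 2)%:E) `^ 2^-1)%E.
Proof.
rewrite /L2dist unlock; congr (_ `^ _)%E; apply: eq_integral => k _.
case: (F k) => x y; case: (G k) => u v /=.
rewrite ger0_norm ?sqrtr_ge0// powR_mulrn ?sqrtr_ge0// sqr_sqrtr//.
by rewrite addr_ge0 ?sqr_ge0.
Qed.

Lemma Lfun2_of_sqr (g : R -> R) : measurable_fun setT g -> summable1 (fun k => g k ^+ 2) ->
  g \in Lfun mu 2%:E.
Proof.
move=> mg ig; rewrite inE; apply/andP; split; rewrite inE//=.
rewrite /finite_norm unlock; apply: poweR_lty.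
under eq_integral => k _ do rewrite /= powR_mulrn// real_normK ?num_real//.
by rewrite -EFin_Rintegral// ltry.
Qed.

Lemma Lfun_measurable p (g : R -> R) : g \in Lfun mu p -> measurable_fun setT g.
Proof. by rewrite inE => /andP[]; rewrite inE. Qed.

Lemma summable1_sqr_of_diff (a A : R -> R) :
  measurable_fun setT a -> summable1 (fun k => (a k - A k) ^+ 2) ->
    summable1 (fun k => A k ^+ 2) ->
  summable1 (fun k => a k ^+ 2).
Proof.
move=> ma iD iA.
apply: summable1_le (summable1D (summable1Z 2 iD) (summable1Z 2 iA));
  first exact: measurable_funX.
move=> k; rewrite ger0_norm ?sqr_ge0//.
by have := sqr_ge0 (a k - A k - A k); lra.
Qed.

(** Rules out the default value 0 of [fourier]: with a witness at hand, [xget] returns a true L^2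
    limit. *)
Lemma is_fourier_exists f (C M : R) : decays f C M -> exists F : R -> R[i], is_fourier f F.
Proof.
move=> df; have [cf _ _ _] := df.
have [a [b [ma mb Hab]]] := transform_limit_exists df.
have mC r := measurable_cos_transform (summable1_trunc r cf).
have mS r := measurable_sin_transform (summable1_trunc r cf).
have [iD _] := Hab 1 (lexx 1); have [iE _] := transform_trunc_le 1 df.
have ia : summable1 (fun k => a k ^+ 2).
  apply: (@summable1_sqr_of_diff _ (cos_transform (trunc f 1))) => //.
    apply: summable1_le iD; first by apply: measurable_funX; exact: measurable_funB.
    by move=> k; rewrite ger0_norm ?sqr_ge0// lerDl sqr_ge0.
  apply: summable1_le iE; first exact: measurable_funX.
  by move=> k; rewrite ger0_norm ?sqr_ge0// lerDl sqr_ge0.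
have ib : summable1 (fun k => b k ^+ 2).
  apply: (@summable1_sqr_of_diff _ (sin_transform (trunc f 1))) => //.
    apply: summable1_le iD; first by apply: measurable_funX; exact: measurable_funB.
    by move=> k; rewrite ger0_norm ?sqr_ge0// lerDr sqr_ge0.
  apply: summable1_le iE; first exact: measurable_funX.
  by move=> k; rewrite ger0_norm ?sqr_ge0// lerDr sqr_ge0.
exists (fun k => (c * a k) +i* - (c * b k)); split.
  split => /=; apply: Lfun2_of_sqr.
  - exact: measurable_funM.
  - by have := summable1Z (c ^+ 2) ia; under eq_fun do rewrite -exprMn.
  - by apply: measurableT_comp => //; exact: measurable_funM.
  - by have := summable1Z (c ^+ 2) ib; under eq_fun do rewrite -exprMn -sqrrN.
pose K := c ^+ 2 * (2 * (2 * pi * C) ^+ 2).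
apply: (@squeeze_cvge _ _ _ _ (cst 0%E) _ (fun r : R => (Num.sqrt (K / r))%:E)).
- near=> r.
  have r1 : 1 <= r by near: r; exact: nbhs_pinfty_ge.
  rewrite L2distE poweR_ge0 /=.
  have [i l] := Hab r r1.
  have -> : (\int[mu]_k ((complex.Re (trunc_fourier f r k) - c * a k) ^+ 2 +
      (complex.Im (trunc_fourier f r k) - - (c * b k)) ^+ 2)%:E)%E =
      (c ^+ 2 * \int[mu]_k ((a k - cos_transform (trunc f r) k) ^+ 2 +
              (b k - sin_transform (trunc f r) k) ^+ 2))%:E.
    rewrite -RintegralZl// EFin_Rintegral; last exact: summable1Z.
    by apply: eq_integral => k _; rewrite trunc_fourierE//=; congr EFin; ring.
  rewrite poweR_EFin lee_fin powR12_sqrt; last first.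
    by rewrite mulr_ge0 ?sqr_ge0// Rintegral_ge0// => k _; rewrite addr_ge0 ?sqr_ge0.
  by apply: ler_wsqrtr; rewrite /K -[leRHS]mulrA ler_wpM2l ?sqr_ge0.
- exact: cvg_cst.
- rewrite -[X in _ --> X%:E]sqrtr0; apply: cvg_EFin; first exact: nearW.
  apply: continuous_cvg; first exact: sqrt_continuous.
  rewrite -(mulr0 K); apply: cvgM; first exact: cvg_cst.
  by apply/gtr0_cvgV0; [exact: nbhs_pinfty_gt|exact: cvg_id].
Unshelve. all: by end_near. Qed.

Lemma fourierP f (C M : R) : decays f C M -> is_fourier f (fourier f).
Proof. by move=> df; apply: xgetPex; exact: is_fourier_exists df. Qed.

(** Stated for every L^2 limit [F], hence valid for the one that [fourier] selects. Convergence to 0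
    in the extended reals also makes the distances eventually finite, which yields the
    integrability. The minus sign comes from the kernel e^(-i k y). *)
Lemma is_fourier_transform_limit f (F : R -> R[i]) : continuous f -> is_fourier f F ->
  [/\ measurable_fun setT (fun k => complex.Re (F k)),
    measurable_fun setT (fun k => complex.Im (F k)) &
   transform_limit f (fun k => c^-1 * complex.Re (F k)) (fun k => - (c^-1 * complex.Im (F
     k)))].
Proof.
move=> cf [[/Lfun_measurable mRe /Lfun_measurable mIm] cvgF]; split => // t t0.
have c0 := fourier_cst_gt0.
(* The L^2 distance carries the factor [c] and a square root; this radius corresponds to the bound
   [t] on the unnormalised integral of squares. *)
have e0 : 0 < c * Num.sqrt t by rewrite mulr_gt0 ?sqrtr_gt0.
have mC r := measurable_cos_transform (summable1_trunc r cf).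
have mS r := measurable_sin_transform (summable1_trunc r cf).
have /fine_cvgP[[r1 [_ Hfin]] /cvgr0_norm_le /(_ _ e0) [r2 [_ Hle]]] := cvgF.
(* The + 1 turns the strict thresholds of neighbourhoods of +oo into a weak one. *)
exists (Num.max r1 r2 + 1) => r rr.
have mr : Num.max r1 r2 < r by rewrite (lt_le_trans _ rr)// ltrDl.
have /Hfin : r1 < r by apply: le_lt_trans mr; rewrite le_max lexx.
have /Hle : r2 < r by apply: le_lt_trans mr; rewrite le_max lexx orbT.
rewrite /= L2distE.
set D := (fun k => (c^-1 * complex.Re (F k) - cos_transform (trunc f r) k) ^+ 2 +
  (- (c^-1 * complex.Im (F k)) - sin_transform (trunc f r) k) ^+ 2).
have mD : measurable_fun setT D.
  apply: measurable_funD; apply: measurable_funX; apply: measurable_funB => //.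
    exact: measurable_funM.
  by apply: measurableT_comp => //; exact: measurable_funM.
have D0 k : 0 <= D k by rewrite addr_ge0 ?sqr_ge0.
have DE k : (complex.Re (trunc_fourier f r k) - complex.Re (F k)) ^+ 2 +
     (complex.Im (trunc_fourier f r k) - complex.Im (F k)) ^+ 2 = c ^+ 2 * D k.
  by rewrite trunc_fourierE//= /D; field; exact: lt0r_neq0.
under eq_integral do rewrite DE.
move=> le_e fin_.
have I0 : (0 <= \int[mu]_k (c ^+ 2 * D k)%:E)%E.
  by apply: integral_ge0 => k _; rewrite lee_fin mulr_ge0 ?sqr_ge0.
have mcD : measurable_fun setT (fun k => c ^+ 2 * D k) by exact: measurable_funM.
have icD : summable1 (fun k => c ^+ 2 * D k).
  apply/ge0_summable1P => //; first by move=> k; rewrite mulr_ge0 ?sqr_ge0.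
  apply: (@lty_poweRy _ _ 2^-1); first by rewrite invr_eq0.
  by rewrite -ge0_fin_numE ?poweR_ge0.
have iD : summable1 D.
  have := summable1Z (c ^- 2) icD.
  by under eq_fun do rewrite mulKf ?expf_neq0 ?(lt0r_neq0 c0)//.
split=> //.
move: le_e; rewrite -EFin_Rintegral// poweR_EFin /= powR12_sqrt; last first.
  by rewrite Rintegral_ge0// => k _; rewrite mulr_ge0 ?sqr_ge0.
rewrite RintegralZl// ger0_norm ?sqrtr_ge0// sqrtrM ?sqr_ge0// sqrtr_sqr (gtr0_norm c0).
by rewrite ler_pM2l// ler_sqrt// ltW.
Qed.

Lemma fourier_inversion f f1 (C M C1 M1 : R) :
  decays f C M -> decays f1 C1 M1 -> (forall x : R, is_derive x 1 f (f1 x)) ->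
  CLfun 1 (fourier f) /\ forall x, (f x)%:C = inverse_fourier (fourier f) x.
Proof.
move=> df df1 ddf; have [cf _ _ _] := df.
have [mRe mIm lim] := is_fourier_transform_limit cf (fourierP df).
set F := fourier f in mRe mIm lim *.
have c0 := fourier_cst_gt0; have cn0 := lt0r_neq0 c0.
have ma : measurable_fun setT (fun k => c^-1 * complex.Re (F k)) by exact: measurable_funM.
have mb : measurable_fun setT (fun k => - (c^-1 * complex.Im (F k))).
  by apply: measurableT_comp => //; exact: measurable_funM.
have [ia ib] := transform_limit_summable df df1 ddf ma mb lim.
split.
  split; apply/Lfun1_integrable.
    by have := summable1Z c ia; under eq_fun do rewrite mulVKf//.
  by have := summable1Z (- c) ib; under eq_fun do rewrite mulrNN mulVKf//.
move=> x; have [HRe HIm] := transform_inversion x df df1 ddf ma mb lim.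
have mc := measurable_cosZ x; have ms := measurable_sinZ x.
have c1 k : `|cos (k * x)| <= 1 by exact: cos_max.
have s1 k : `|sin (k * x)| <= 1 by exact: sin_max.
rewrite inverse_fourierE.
have -> : \int[mu]_k (complex.Re (F k) * cos (k * x) - complex.Im (F k) * sin (k * x)) =
    c * (2 * pi * f x).
  rewrite -HRe -RintegralZl//; last first.
    by apply: summable1D; [exact: summable1M ia|exact: summable1M ib].
  by apply: eq_Rintegral => k _; field.
have -> : \int[mu]_k (complex.Re (F k) * sin (k * x) + complex.Im (F k) * cos (k * x)) =
  - c * 0.
  rewrite -HIm -RintegralZl//; last first.
    by apply: summable1B; [exact: summable1M ib|exact: summable1M ia].
  by apply: eq_Rintegral => k _; field.
(* The constants of the two transforms multiply to 1 / (2 pi), which cancels the mass of the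
   kernel. *)
rewrite !mulr0 mulrA -expr2 sqr_fourier_cst mulKf//.
by rewrite gt_eqF// mulr_gt0// pi_gt0.
Qed.

(** * From the hypotheses of the theorem to explicit bounds *)

Lemma decays_of_very_moderate_decrease f : very_moderate_decrease f -> bounded_fun f ->
  exists C M : R, decays f C M.
Proof.
(* Boundedness supplies a bound for every number strictly above [M], hence [M + 1]. *)
move=> [cf [C C0 fC]] [M [_ HM]]; exists C, (M + 1); split => // x.
by apply: HM => //; rewrite ltrDl.
Qed.

Lemma fourier_inversion_C1 f : class_C 3 f ->
  very_moderate_decrease f -> very_moderate_decrease f^`() ->
  bounded_fun f -> bounded_fun f^`() ->
  CLfun 1 (fourier f) /\ forall x, (f x)%:C = inverse_fourier (fourier f) x.
Proof.
move=> [df _] vf vf1 bf bf1.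
have [C [M decf]] := decays_of_very_moderate_decrease vf bf.
have [C1 [M1 decf1]] := decays_of_very_moderate_decrease vf1 bf1.
apply: fourier_inversion decf decf1 _ => x.
rewrite derive1E; apply: DeriveDef => //.
(* The clause of order 0 in [class_C] is the derivability of [f] itself. *)
exact: (df 0%N x isT).
Qed.

End FourierInversion.

Theorem lemma0p16 (R : realType) :
  (forall f : R -> R,
     class_C 3 f ->
     very_moderate_decrease f -> very_moderate_decrease f^`() ->
     very_moderate_decrease f^`(2) ->
     bounded_fun f -> bounded_fun f^`() ->
     bounded_fun f^`(2) -> bounded_fun f^`(3) ->
     CLfun 1 (fourier f) /\
     forall x, (f x)%:C = inverse_fourier (fourier f) x) /\
  (forall f : R -> R,
     class_C 3 f ->
     very_moderate_decrease f ->
     very_moderate_decrease f^`() -> oscillatory f^`() ->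
     bounded_fun f -> bounded_fun f^`() ->
     bounded_fun f^`(2) -> bounded_fun f^`(3) ->
     CLfun 1 (fourier f) /\
     forall x, (f x)%:C = inverse_fourier (fourier f) x).
Proof.
by split=> f cf vf vf1 _ bf bf1 _ _; exact: fourier_inversion_C1.
Qed.
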